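(* Consider the regression model $Y_i=\mathbf 1(X_i\in G)+\xi_i$, $i=1,\dots,n$, with i.i.d. subgaussian noise independent of the design, and let $h=h_n>0$. Consider testing $H_0: G=\emptyset$ against $H_1: |G|\ge h$. (1) Assume that the design is (DD) or (RD) and that the noise satisfies $\mathbb P[\xi_1\le -1/2]<\mathbb P[\xi_1\le 1/2]$. Let $c$ be any number with $\mathbb P[\xi_1\le -1/2]<c<\mathbb P[\xi_1\le 1/2]$, and let $T_n^0=\mathbf 1(S\le cN)$, where $N=\#\{i: X_i\le h\}$ and $S=\#\{i=1,\dots,N: Y_i\le 1/2\}$. If $nh\to\infty$ as $n\to\infty$, then $T_n^0$ is consistent on $\mathcal S_0$, i.e. $\gamma_n(T_n^0,\mathcal S_0)\to 0$. In addition, if the noise is Gaussian, then $r_n=1/n$ is a separation rate on the class $\mathcal S_0$. (2) Assume that the design is (DD) or (RD). For $G'\in\mathcal S$ let $R(G')=\sum_{i=1}^n Y_i\mathbf 1(X_i\in G')-\frac12\#\{i: X_i\in G'\}$, let $R=\sup_{G'\in\mathcal S,\,|G'|\ge h}R(G')$, and let $T_n^1=\mathbf 1(R\ge 0)$. If $nh/\ln n\to\infty$ as $n\to\infty$, then $T_n^1$ is consistent on $\mathcal S$, i.e. $\gamma_n(T_n^1,\mathcal S)\to0$. In addition, if the noise is Gaussian, then $r_n=(\ln n)/n$ is a separation rate on the class $\mathcal S$.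
   Context: Model: one observes $(X_1,Y_1),\dots,(X_n,Y_n)$ with $Y_i=\mathbf 1(X_i\in G)+\xi_i$, where $G\subseteq[0,1]$ is an unknown segment (possibly empty). The noise variables $\xi_1,\dots,\xi_n$ are i.i.d., independent of the design, with a law not depending on $n$, and subgaussian: $\mathbb E[e^{u\xi_i}]\le e^{\sigma^2u^2/2}$ for all $u\in\mathbb R$, for some constant $\sigma>0$. ''Gaussian noise'' means $\xi_i\sim N(0,\sigma^2)$ with fixed $\sigma^2>0$. Designs: (DD) $X_i=i/n$, $i=1,\dots,n$; (RD) $X_1\le\dots\le X_n$ is the increasing reordering of $n$ i.i.d. uniform random variables on $[0,1]$. Classes: $\mathcal S=\{[a,b]:0\le a\le b\le1\}$ and $\mathcal S_0=\{[0,\theta]:0\le\theta\le1\}$. $|G|$ is the length of $G$. $\mathbb P_G$ denotes the law of the observations when the segment is $G$ ($\mathbb P_\emptyset$: $Y_i=\xi_i$). A test $\tau_n$ is a $\{0,1\}$-valued measurable function of the $n$ observations. Its performance on a class $\mathcal C$ is $\gamma_n(\tau_n,\mathcal C)=\mathbb P_\emptyset[\tau_n=1]+\sup_{G\in\mathcal C,\,|G|\ge h}\mathbb P_G[\tau_n=0]$ (a supremum over the empty set being $0$). A sequence of tests is consistent on $\mathcal C$ if $\gamma_n(\tau_n,\mathcal C)\to0$ as $n\to\infty$. A separation rate on $\mathcal C$ is a sequence $r_n>0$ such that: if $h/r_n\to\infty$, then there exists a consistent test on $\mathcal C$; and if $h/r_n\to0$, then no test is consistent on $\mathcal C$. *)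

(* Defs.v *)
From HB Require Import structures.
From mathcomp Require Import all_boot all_order all_algebra.
From mathcomp Require Import all_classical all_reals all_analysis.

Set Implicit Arguments.
Unset Strict Implicit.
Unset Printing Implicit Defensive.

Import Order.TTheory GRing.Theory Num.Theory.
Import numFieldNormedType.Exports.

Local Open Scope classical_set_scope.
Local Open Scope ring_scope.

(* DD: the deterministic grid i/n; RD: ordered i.i.d. uniform points. *)
Variant design := DD | RD.

Definition subgaussian (R : realType) (mu : probability R R) :=
  exists2 s : R, 0 < s & forall u : R,
    (\int[mu]_x (expR (u * x))%:E <= (expR (s ^+ 2 * u ^+ 2 / 2))%:E)%E.

(* The second parameter of normal_prob is the standard deviation. *)
Definition gaussian (R : realType) (mu : probability R R) :=
  exists2 s : R, 0 < s &
    forall A : set R, measurable A -> mu A = normal_prob 0 s A.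

Section model.
Context (R : realType).

Section random_variables.
Context d (T : measurableType d) (P : probability T R) (n : nat).
Implicit Type X : 'I_n -> {RV P >-> R}.

Definition mutually_independent X :=
  forall (J : {set 'I_n}) (A : 'I_n -> set R), (forall i, measurable (A i)) ->
    P (\bigcap_(i in [set` J]) (X i @^-1` A i)) =
    (\prod_(i in J) P (X i @^-1` A i))%E.

Definition has_law X (nu : set R -> \bar R) :=
  forall i (A : set R), measurable A -> distribution P (X i) A = nu A.

Definition vector X (w : T) : n.-tuple R := [tuple X i w | i < n].

Definition independent_vectors X X' :=
  forall A B : set (n.-tuple R), measurable A -> measurable B ->
    P ((vector X @^-1` A) `&` (vector X' @^-1` B)) =
    (P (vector X @^-1` A) * P (vector X' @^-1` B))%E.

Definition follows_design (D : design) X : Prop :=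
  match D with
  | DD => forall i w, X i w = i.+1%:R / n%:R
  | RD => exists U : 'I_n -> {RV P >-> R},
      [/\ mutually_independent U,
          has_law U (uniform_prob (@ltr01 R)) &
          forall w, vector X w = sort <=%R (vector U w) :> seq R]
  end.

End random_variables.

(* The probability space may change with the sample size n; only the noise
   law mu is common to all n. *)
Record experiment (D : design) (mu : probability R R) (n : nat) := Experiment {
  disp : measure_display ;
  Omega : measurableType disp ;
  Prob : probability Omega R ;
  dpoint : 'I_n -> {RV Prob >-> R} ;
  noise : 'I_n -> {RV Prob >-> R} ;
  dpointP : follows_design D dpoint ;
  noise_law : has_law noise mu ;
  noise_indep : mutually_independent noise ;
  dpoint_noise_indep : independent_vectors dpoint noise }.

Definition segments : set (set R) :=
  [set G | exists a b : R, [/\ 0 <= a, a <= b, b <= 1 & G = `[a, b]%classic]].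

Definition segments0 : set (set R) :=
  [set G | exists t : R, [/\ 0 <= t, t <= 1 & G = `[0, t]%classic]].

Definition long (h : R) : set (set R) :=
  [set G | (h%:E <= lebesgue_measure G)%E].

(* An observation is the vector of pairs (X_i, Y_i); a test is the boolean
   function telling whether H_0 is rejected. *)
Definition obs (n : nat) := n.-tuple (R * R)%type.

Section experiment_theory.
Context (D : design) (mu : probability R R).

Definition observe n (E : experiment D mu n) (G : set R) (w : Omega E) : obs n :=
  [tuple (dpoint E i w, \1_G (dpoint E i w) + noise E i w) | i < n].

Definition P_ n (E : experiment D mu n) (G : set R) : set (obs n) -> \bar R :=
  pushforward (Prob E) (observe (E := E) G).

(* Adding 0 makes the supremum over an empty class equal to 0. *)
Definition gamma n (E : experiment D mu n) (C : set (set R)) (h : R)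
    (tau : obs n -> bool) : \bar R :=
  (P_ E set0 [set x | tau x] +
   ereal_sup (0 |` [set P_ E G [set x | ~~ tau x] | G in C `&` long h]))%E.

Definition consistent (E : forall n, experiment D mu n) (C : set (set R))
    (h : nat -> R) (tau : forall n, obs n -> bool) : Prop :=
  (forall n, measurable_fun [set: obs n] (tau n)) /\
  gamma (E n) C (h n) (@tau n) @[n --> \oo] --> 0%E.

(* Positivity is only required for large n, as (ln n) / n vanishes at n = 1
   (and at n = 0). *)
Definition separation_rate (E : forall n, experiment D mu n)
    (C : set (set R)) (r : nat -> R) : Prop :=
  (\forall n \near \oo, 0 < r n) /\
  forall h : nat -> R, (forall n, 0 < h n) ->
    (h n / r n @[n --> \oo] --> +oo -> exists tau, consistent E C h tau) /\
    (h n / r n @[n --> \oo] --> 0 -> ~ exists tau, consistent E C h tau).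

End experiment_theory.

Section tests.
Context (n : nat) (h : R) (z : obs n).

Definition Xs (i : 'I_n) : R := (tnth z i).1.
Definition Ys (i : 'I_n) : R := (tnth z i).2.

Definition N_stat : nat := #|[set i | Xs i <= h]%SET|.

(* Indices are shifted by one: i = 1, ..., N becomes i = 0, ..., N - 1. *)
Definition S_stat : nat :=
  #|[set i : 'I_n | (i < N_stat)%N && (Ys i <= 1 / 2)]%SET|.

Definition R_score (G : set R) : R :=
  \sum_(i < n) Ys i * \1_G (Xs i) - 1 / 2 * #|[set i | Xs i \in G]%SET|%:R.

Definition R_stat : \bar R :=
  ereal_sup [set (R_score G)%:E | G in segments `&` long h].

End tests.

Definition T0 (c : R) (h : nat -> R) n (z : obs n) : bool :=
  (S_stat (h n) z)%:R <= c * (N_stat (h n) z)%:R.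

Definition T1 (h : nat -> R) n (z : obs n) : bool := (0 <= R_stat (h n) z)%E.

End model.

(* Main.v *)
(* Upper bounds. Both kinds of errors are covered by two events: one on the
   design alone (some segment contains too few design points) and one on the
   noise alone. For S_0 the latter is a deviation of the empirical frequencies
   over some prefix i < k, k >= m, of the noise; the Chernoff bounds sum
   geometrically, so no logarithm is lost. For S it is a deviation of the sum of
   the noise over some block of consecutive indices; as the design is sorted,
   there are at most (n+1)^2 blocks, and this union bound costs ln n.

   Lower bounds. On S_0, the observations under [0, h] and under the empty set
   coincide unless some design point falls into [0, h], which has probability at
   most nh. On S, the test has to compete with the average likelihood ratio Lbar
   of M ~ 1/(2h) disjoint segments; since min(1, Lbar) >= Lbar - Lbar^2 / 4, it
   suffices that E[Lbar^2] <= 2. By the Cameron-Martin formula, applied one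
   coordinate at a time, the mixed moments are 1 and each of the M second moments
   is E[exp(N / s^2)], N being the number of design points in the segment; this
   is n^o(1) when h = o(ln n / n). *)

(* The experiments live on arbitrary probability spaces and independence is only a product formula
   for events. Integrals are therefore computed by resampling: one noise coordinate, or the whole
   noise vector given the design, is replaced by an integral against its law ([ge0_integral_coord],
   [ge0_integral_indep]). Moment bounds and the change of measure are inductions on coordinates
   built on this.

   The statistic of [T0] involves a random number of observations, and the scan of [T1] a random
   family of index sets. Making the noise events uniform over all prefixes or blocks whose size is
   at least a fixed fraction of nh avoids conditioning on the design. Apart from being sorted, the
   random design enters only through order-free counts, so these are computed on the i.i.d. sample,
   and both designs share one lower-tail bound and one exponential moment bound. *)
Require Import Defs.
From mathcomp Require Import all_boot all_order all_algebra.
From mathcomp Require Import all_classical all_reals all_analysis.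
From mathcomp Require Import measurable_realfun zify ring lra.

Set Implicit Arguments.
Unset Strict Implicit.
Unset Printing Implicit Defensive.

Import Order.TTheory GRing.Theory Num.Theory.
Import numFieldNormedType.Exports.

Local Open Scope classical_set_scope.
Local Open Scope ring_scope.

(** * Densities and shifts of normal laws *)

Section density.
Context d (T : measurableType d) (R : realType).
Variables (m nu : {measure set T -> \bar R}) (f : T -> R).
Hypotheses (mf : measurable_fun [set: T] f) (f0 : forall x, 0 <= f x)
  (nuE : forall A, measurable A -> nu A = (\int[m]_(x in A) (f x)%:E)%E).
Local Open Scope ereal_scope.

Let integral_density_indic E : measurable E ->
  \int[nu]_x (\1_E x)%:E = \int[m]_x ((\1_E x)%:E * (f x)%:E).
Proof.
move=> mE; rewrite integral_indic// setIT nuE// [LHS]integral_mkcond/=.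
apply: eq_integral => x _; rewrite patchE indicE; case: ifPn => xE.
  by rewrite mul1e.
by rewrite mul0e.
Qed.

Import HBNNSimple.

Let integral_density_nnsfun (h : {nnsfun T >-> R}) :
  \int[nu]_x (h x)%:E = \int[m]_x ((h x)%:E * (f x)%:E).
Proof.
under [LHS]eq_integral do rewrite fimfunE -fsumEFin//.
rewrite [LHS]ge0_integral_fsum//; last 2 first.
  - by move=> r; exact/measurable_EFinP/measurableT_comp.
  - by move=> n x _; rewrite EFinM nnfun_muleindic_ge0.
under [RHS]eq_integral.
  move=> x xD; rewrite fimfunE -fsumEFin// ge0_mule_fsuml; last first.
    by move=> r; exact: nnfun_muleindic_ge0.
  over.
rewrite [RHS]ge0_integral_fsum//; last 2 first.
  - move=> r; apply: emeasurable_funM; apply/measurable_EFinP => //.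
    by apply: measurableT_comp.
  - move=> r x _; apply: mule_ge0; last by rewrite lee_fin.
    exact: nnfun_muleindic_ge0.
apply: eq_fsbigr => r _.
have [r0|r0] := leP 0%R r.
  under [LHS]eq_integral do rewrite EFinM.
  under [RHS]eq_integral do rewrite EFinM -muleA.
  rewrite !ge0_integralZl//.
  - by rewrite integral_density_indic.
  - by apply: emeasurable_funM; apply/measurable_EFinP.
  - by move=> x _; rewrite mule_ge0// lee_fin.
  - by apply/measurable_EFinP.
have h0 : h @^-1` [set r] = set0 by exact: preimage_nnfun0.
rewrite h0 !integral0_eq// => x _; rewrite indicE in_set0 mulr0//.
by rewrite mul0e.
Qed.

(** Extended from indicators to simple functions and then, by monotone convergence, to nonnegative
    functions. *)
Lemma ge0_integral_density (F : T -> \bar R) :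
  measurable_fun [set: T] F -> (forall x, 0 <= F x) ->
  \int[nu]_x F x = \int[m]_x (F x * (f x)%:E).
Proof.
move=> mF F0; pose F_ := nnsfun_approx measurableT mF.
have F_cvg x : (EFin \o F_ ^~ x) @ \oo --> F x by apply: cvg_nnsfun_approx.
transitivity (limn (fun n => \int[nu]_x (F_ n x)%:E)).
  rewrite -monotone_convergence//=.
  - by apply: eq_integral => x _; apply/esym/cvg_lim => //; exact: F_cvg.
  - by move=> n; exact/measurable_EFinP/measurable_funTS.
  - by move=> n x _; rewrite lee_fin.
  - by move=> x _ a b ab; rewrite lee_fin; exact/lefP/nd_nnsfun_approx.
transitivity (limn (fun n => \int[m]_x ((F_ n x)%:E * (f x)%:E))).
  by apply: congr_lim; apply/funext => n; exact: integral_density_nnsfun.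
rewrite -monotone_convergence//=.
- apply: eq_integral => x _; apply/cvg_lim => //.
  by apply: cvgeZr => //; exact: F_cvg.
- move=> n; apply: emeasurable_funM; apply/measurable_EFinP => //.
- by move=> n x _; rewrite mule_ge0// lee_fin.
- move=> x _ a b ab; rewrite lee_wpmul2r ?lee_fin//.
  exact/lefP/nd_nnsfun_approx.
Qed.

End density.

Section normal_shift.
Context (R : realType).
Local Notation leb := (@lebesgue_measure R).
Local Open Scope ereal_scope.

Lemma ge0_integral_shift (a : R) (F : measurableTypeR R -> \bar R) :
  measurable_fun [set: measurableTypeR R] F -> (forall x, 0 <= F x) ->
  \int[leb]_x F (x + a)%R = \int[leb]_x F x.
Proof.
move=> mF F0.
pose sh (x : measurableTypeR R) : measurableTypeR R := (x + a)%R.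
have ma : measurable_fun [set: measurableTypeR R] sh.
  exact: (@measurable_funD _ R).
rewrite -[LHS]/(\int[leb]_(x in sh @^-1` setT) (F \o sh) x).
rewrite -ge0_integral_pushforward//.
apply: eq_measure_integral => //= A mA _.
(* The image of Lebesgue measure under the shift gives half-open intervals their length, which
   characterizes Lebesgue measure. *)
apply/esym; apply: lebesgue_measure_unique => //= _ [[b c]] _ <-.
rewrite /pushforward [X in _ = leb X](_ : _ = `](b - a), (c - a)]%classic%R).
  rewrite !lebesgue_measure_itv/= !lte_fin ltrD2r -!EFinB.
  by congr (if _ then _%:E else _); ring.
by apply/seteqP; split=> x /=; rewrite !in_itv/= ltrBlDr lerBrDr.
Qed.

(* [lebesgue_measure] and [uniform_prob] live on [measurableTypeR R], whose
   display is not the one of [R]; they are transported to [R] along [idR]. *)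
Definition idR : measurableTypeR R -> R := idfun.

Lemma measurable_idR : measurable_fun [set: measurableTypeR R] idR.
Proof. by move=> _ A mA; rewrite setTI. Qed.

Let lebR : {measure set R -> \bar R} :=
  measure_function_pushforward__canonical__measure_function_Measure
    leb measurable_idR.

Let integral_lebR D (F : R -> \bar R) : measurable D ->
  measurable_fun D F -> (forall x, 0 <= F x) ->
  \int[lebR]_(x in D) F x = \int[leb]_(x in D) F x.
Proof. by move=> mD mF F0; rewrite (ge0_integral_pushforward measurable_idR). Qed.

(** One-dimensional Cameron-Martin formula: the exponential is the density of N(1, s^2) with respect
    to N(0, s^2). *)
Lemma ge0_integral_normal_shift (s : R) (nu : probability R R)
    (F : R -> \bar R) : s != 0%R ->
  (forall A, measurable A -> nu A = normal_prob 0 s A) ->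
  measurable_fun [set: R] F -> (forall x, 0 <= F x) ->
  \int[nu]_x F (x + 1)%R =
  \int[nu]_x (F x * (expR (x / s ^+ 2 - (s ^+ 2)^-1 / 2))%:E).
Proof.
move=> s0 nuE mF F0.
have m1 : measurable_fun [set: R] (fun x : R => F (x + 1)%R).
  by apply: measurableT_comp => //; exact: measurable_funD.
have mg : measurable_fun [set: R]
    (fun x : R => expR (x / s ^+ 2 - (s ^+ 2)^-1 / 2)).
  apply: measurableT_comp => //; apply: measurable_funB => //.
  exact: measurable_funM.
have mn := measurable_normal_pdf 0 s.
have nuF H : measurable_fun [set: R] H -> (forall x, 0 <= H x) ->
    \int[nu]_x H x = \int[leb]_x (H x * (normal_pdf 0 s x)%:E).
  move=> mH H0.
  rewrite (@ge0_integral_density _ _ _ lebR nu (normal_pdf 0 s))//; last 2 first.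
  - by move=> x; exact: normal_pdf_ge0.
  - move=> A mA; rewrite integral_lebR//; first exact: nuE.
    + exact/measurable_funTS/measurable_EFinP.
    + by move=> x; rewrite lee_fin normal_pdf_ge0.
  rewrite integral_lebR//.
  - by apply: emeasurable_funM => //; exact/measurable_EFinP.
  - by move=> x; rewrite mule_ge0// lee_fin normal_pdf_ge0.
rewrite !nuF//; last 2 first.
- by apply: emeasurable_funM => //; exact/measurable_EFinP.
- by move=> x; rewrite mule_ge0// lee_fin expR_ge0.
rewrite -(@ge0_integral_shift 1
  (fun x => F x * (expR (x / s ^+ 2 - (s ^+ 2)^-1 / 2))%:E *
     (normal_pdf 0 s x)%:E)); last 2 first.
- apply: (@emeasurable_funM _ R); last exact/measurable_EFinP.
  by apply: emeasurable_funM => //; exact/measurable_EFinP.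
- by move=> x; rewrite !mule_ge0// lee_fin ?expR_ge0// normal_pdf_ge0.
apply: eq_integral => x _; rewrite -muleA; congr (_ * _).
rewrite -EFinM; congr EFin; rewrite /normal_pdf (negbTE s0) /normal_fun.
rewrite mulrCA -expRD; congr (_ * expR _)%R.
by rewrite -(mulr_natr (s ^+ 2) 2); field.
Qed.

End normal_shift.

(** * Independence *)

Section indep.
Context (R : realType) d (T : measurableType d) (P : probability T R).
Local Open Scope ereal_scope.

(** The product formula on rectangles identifies the law of the pair as a product measure; Tonelli's
    theorem does the rest. *)
Lemma ge0_integral_indep d1 d2 (T1 : measurableType d1) (T2 : measurableType d2)
    (V : {mfun T >-> T1}) (Z : {mfun T >-> T2}) (nu : probability T2 R)
    (F : T1 * T2 -> \bar R) :
  (forall A B, measurable A -> measurable B ->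
    P ((V @^-1` A) `&` (Z @^-1` B)) = P (V @^-1` A) * nu B) ->
  measurable_fun [set: T1 * T2] F -> (forall x, 0 <= F x) ->
  \int[P]_w F (V w, Z w) = \int[P]_w \int[nu]_z F (V w, z).
Proof.
move=> indepVZ mF F0.
have mVZ : measurable_fun [set: T] (fun w => (V w, Z w)).
  by apply/measurable_fun_pair; exact: measurable_funPT.
pose VZ : {mfun T >-> (T1 * T2)%type} := mfun_Sub (mem_set mVZ).
transitivity (\int[distribution P VZ]_x F x).
  by rewrite ge0_integral_distribution.
transitivity (\int[distribution P V \x nu]_x F x).
  apply: eq_measure_integral => A mA _.
  apply/esym; apply: product_measure_unique mA => B C; exact: indepVZ.
rewrite fubini_tonelli1//.
rewrite ge0_integral_distribution//; first exact: measurable_fun_fubini_tonelli_F.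
by move=> x; apply: integral_ge0.
Qed.

End indep.

Section tuple_boxes.
Context d (T : measurableType d) (n : nat).

Definition box (A : 'I_n -> set T) : set (n.-tuple T) :=
  [set v | forall i, A i (tnth v i)].

Definition boxes : set (set (n.-tuple T)) :=
  [set box A | A in [set A | forall i, measurable (A i)]].

Lemma measurable_box (A : 'I_n -> set T) :
  (forall i, measurable (A i)) -> measurable (box A).
Proof.
move=> mA; rewrite (_ : box A = \bigcap_i ((@tnth _ T ^~ i) @^-1` A i)).
  apply: fin_bigcap_measurable; first exact: finite_finset.
  by move=> i _; rewrite -[X in measurable X]setTI; exact: measurable_tnth.
by apply/seteqP; split => [v Av i _|v Av i]; [exact: Av | exact: (Av i I)].
Qed.

Lemma measurable_tupleE : @measurable _ (n.-tuple T) = <<s boxes >>.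
Proof.
apply/seteqP; split; last first.
  apply: smallest_sub; first exact: sigma_algebra_measurable.
  by move=> _ [A mA <-]; exact: measurable_box.
apply: smallest_sub; first exact: smallest_sigma_algebra.
rewrite -bigcup_seq; apply: bigcup_sub => i _ _ [Y mY <-].
(* A generating cylinder is a box with a single constrained side. *)
apply: sub_sigma_algebra; exists (fun j => if j == i then Y else setT).
  by move=> j /=; case: ifP.
apply/seteqP; split => [v /(_ i)|v [_ Yv] j]; rewrite ?eqxx// /box/=.
by case: ifP => // /eqP ->.
Qed.

(** Boxes are stable under intersection and generate the sigma-algebra, so finite measures are
    determined by them. *)
Lemma measure_tuple_unique (R : realType)
    (m1 m2 : {measure set (n.-tuple T) -> \bar R}) : (m1 setT < +oo)%E ->
  (forall A : 'I_n -> set T, (forall i, measurable (A i)) ->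
    m1 (box A) = m2 (box A)) ->
  forall B, measurable B -> m1 B = m2 B.
Proof.
move=> m1oo m12; have boxT : box (fun=> setT) = setT.
  by apply/seteqP; split.
apply: (measure_unique boxes (fun=> setT)) => //.
- exact: measurable_tupleE.
- move=> _ _ [A mA <-] [B mB <-]; exists (fun i => A i `&` B i).
    by move=> i; exact: measurableI.
  apply/seteqP; split => v; first by move=> AB; split=> i; have [] := AB i.
  by move=> [Av Bv] i; split.
- by move=> _; exists (fun=> setT).
- by rewrite bigcup_const.
- by move=> _ [A mA <-]; exact: m12.
Qed.

End tuple_boxes.

Section coordinates.
Context (R : realType) (n : nat).

(** Overwriting a coordinate, instead of deleting it, keeps all vectors in the same space of
    n-tuples during the inductions. *)
Definition set_coord (v : n.-tuple R) (i : 'I_n) (x : R) : n.-tuple R :=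
  [tuple if j == i then x else tnth v j | j < n].

Lemma tnth_set_coord v i x j :
  tnth (set_coord v i x) j = if j == i then x else tnth v j.
Proof. by rewrite tnth_mktuple. Qed.

Lemma measurable_set_coord i :
  measurable_fun [set: n.-tuple R * R] (fun vx => set_coord vx.1 i vx.2).
Proof.
apply/measurable_fun_tnthP => j.
rewrite (_ : _ \o _ = fun vx : n.-tuple R * R =>
  if j == i then vx.2 else tnth vx.1 j); last first.
  by apply/funext => vx /=; rewrite tnth_set_coord.
case: (j == i); first exact: measurable_snd.
by apply: measurableT_comp (measurable_tnth j) _; exact: measurable_fst.
Qed.

End coordinates.

Section mutual_independence.
Context (R : realType) d (T : measurableType d) (P : probability T R) (n : nat).
Variable Z : 'I_n -> {RV P >-> R}.
Local Open Scope ereal_scope.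

Lemma tnth_vector w i : tnth (vector Z w) i = Z i w.
Proof. by rewrite tnth_mktuple. Qed.

Lemma measurable_vector : measurable_fun [set: T] (vector Z).
Proof.
apply/measurable_fun_tnthP => i.
rewrite (_ : _ \o _ = Z i); first exact: measurable_funPT.
by apply/funext => w /=; rewrite tnth_mktuple.
Qed.

Hypothesis indepZ : mutually_independent Z.

Let Z0 (i : 'I_n) (w : T) := set_coord (vector Z w) i 0.

Let measurable_Z0 i : measurable_fun [set: T] (Z0 i).
Proof.
apply: (@measurableT_comp _ _ _ _ _ _ (fun vx => set_coord vx.1 i vx.2) _
  (fun w => (vector Z w, 0%R))); first exact: measurable_set_coord.
by apply/measurable_fun_pair => //; exact: measurable_vector.
Qed.

Let indep_Z0_box i A C : (forall j, measurable (A j)) -> measurable C ->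
  P ((Z0 i @^-1` box A) `&` (Z i @^-1` C)) =
  P (Z0 i @^-1` box A) * P (Z i @^-1` C).
Proof.
(* The erased coordinate is constantly 0, so the i-th side of the box is met either always or
   never. *)
move=> mA mC; have [Ai0|Ai0] := pselect (A i 0%R); last first.
  rewrite (_ : Z0 i @^-1` box A = set0) ?set0I ?measure0 ?mul0e//.
  apply/seteqP; split => w //= /(_ i).
  by rewrite tnth_set_coord eqxx.
(* Used with D = C and with D = setT. The family [AD] puts D in the i-th slot, which the box leaves
   free. *)
have Z0E D : measurable D -> P ((Z0 i @^-1` box A) `&` (Z i @^-1` D)) =
    P (Z i @^-1` D) * \prod_(j < n | j != i) P (Z j @^-1` A j).
  move=> mD; pose AD j := if j == i then D else A j.
  have ADi : AD i = D by rewrite /AD eqxx.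
  have := @indepZ [set: 'I_n]%SET AD; rewrite (bigD1 i) ?inE//= ADi.
  rewrite (eq_bigl (fun j => j != i)); last by move=> j; rewrite inE.
  rewrite (eq_bigr (fun j => P (Z j @^-1` A j))); last first.
    by move=> j /negbTE ji; rewrite /AD ji.
  move=> <-; last by move=> j; rewrite /AD; case: ifP.
  congr (P _); apply/seteqP; split => w /=.
    move=> [Aw Dw] j _ /=; rewrite /AD; case: eqVneq => [->//|ji].
    by have := Aw j; rewrite tnth_set_coord (negbTE ji) tnth_mktuple.
  move=> ADw; split; last first.
    by have := ADw i; rewrite /AD/= inE eqxx; apply.
  move=> j; rewrite tnth_set_coord tnth_mktuple; case: eqVneq => [->//|ji].
  by have := ADw j; rewrite /AD/= inE (negbTE ji); apply.
rewrite Z0E// -[X in _ = P X * _]setIT -(preimage_setT (Z i)) Z0E//.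
by rewrite preimage_setT probability_setT mul1e muleC.
Qed.

(* The value 0 is arbitrary: it erases the i-th coordinate. *)
Lemma indep_set_coord i B C : measurable B -> measurable C ->
  P (((fun w => set_coord (vector Z w) i 0) @^-1` B) `&` (Z i @^-1` C)) =
  P ((fun w => set_coord (vector Z w) i 0) @^-1` B) * P (Z i @^-1` C).
Proof.
move=> mB mC.
have mZC : measurable (Z i @^-1` C).
  by rewrite -[X in measurable X]setTI; exact: measurable_funPT.
(* For fixed C, both sides are finite measures in B, [m1] and [m2]; it suffices to compare them on
   boxes. *)
pose r : {nonneg R} := NngNum (fine_ge0 (measure_ge0 P (Z i @^-1` C))).
have rE : (r%:num)%:E = P (Z i @^-1` C).
  by rewrite fineK//; exact: fin_num_measure.
pose z : {mfun T >-> n.-tuple R} := mfun_Sub (mem_set (measurable_Z0 i)).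
pose PC : {measure set T -> \bar R} := mrestr P mZC.
pose m1 : {measure set (n.-tuple R) -> \bar R} :=
  measure_function_pushforward__canonical__measure_function_Measure
    PC (measurable_Z0 i).
pose m2 : {measure set (n.-tuple R) -> \bar R} := mscale r (distribution P z).
suff : m1 B = m2 B.
  by rewrite /m1 /m2 /= /mscale /pushforward /mrestr /= rE muleC.
apply: measure_tuple_unique => //.
  rewrite /m1 /= /pushforward /mrestr /=.
  by rewrite preimage_setT setTI ltey_eq fin_num_measure.
move=> A mA; rewrite /m1 /m2 /= /mscale /pushforward /mrestr /= rE muleC.
exact: indep_Z0_box.
Qed.

(** The vector with its i-th entry erased still carries all other coordinates and is independent of
    the i-th one, which may thus be averaged under its own law. This is the induction step of the
    product formulas below. *)
Lemma ge0_integral_coord (nu : probability R R) i (H : n.-tuple R -> \bar R) :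
  (forall A, measurable A -> P (Z i @^-1` A) = nu A) ->
  measurable_fun [set: n.-tuple R] H -> (forall v, 0 <= H v) ->
  \int[P]_w H (vector Z w) = \int[P]_w \int[nu]_x H (set_coord (vector Z w) i x).
Proof.
move=> nuE mH H0.
pose z : {mfun T >-> n.-tuple R} := mfun_Sub (mem_set (measurable_Z0 i)).
pose F (vx : n.-tuple R * R) := H (set_coord vx.1 i vx.2).
have zK w x : set_coord (z w) i x = set_coord (vector Z w) i x.
  apply: eq_from_tnth => j; rewrite !tnth_set_coord.
  by case: eqVneq => // ji; rewrite (negbTE ji).
transitivity (\int[P]_w F (z w, Z i w)).
  apply: eq_integral => w _; rewrite /F/= zK; congr H.
  apply: eq_from_tnth => j; rewrite tnth_set_coord.
  by case: eqVneq => [->|//]; rewrite tnth_vector.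
rewrite (@ge0_integral_indep _ _ _ _ _ _ _ _ z (Z i) nu).
- by apply: eq_integral => w _; apply: eq_integral => x _; rewrite /F/= zK.
- move=> A B mA mB; rewrite -nuE//; exact: indep_set_coord.
- by apply: measurableT_comp => //; exact: measurable_set_coord.
- by move=> x; exact: H0.
Qed.

End mutual_independence.

(** * Chernoff bounds *)

Section chernoff.
Context (R : realType) d (T : measurableType d) (P : probability T R).
Local Open Scope ereal_scope.

Lemma markov_ge0 (g : T -> R) (a B : R) : (0 < a)%R ->
  measurable_fun [set: T] g -> (forall w, 0 <= g w)%R ->
  \int[P]_w (g w)%:E <= B%:E -> P [set w | a <= g w]%R <= (B / a)%:E.
Proof.
move=> a0 mg g0 gB; set A := [set w | _].
have mA : measurable A.
  rewrite -[A]setTI; have -> : A = g @^-1` `[a, +oo[%classic.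
    by apply/seteqP; split => w /=; rewrite /A/= in_itv/= andbT.
  exact: mg.
rewrite EFinM lee_pdivlMr// muleC (le_trans _ gB)//.
have <- : \int[P]_w (a%:E * (\1_A w)%:E) = a%:E * P A.
  rewrite ge0_integralZl//; first by rewrite integral_indic// setIT.
  - exact/measurable_EFinP.
  - by rewrite lee_fin ltW.
apply: ge0_le_integral => //.
- by move=> w _; rewrite -EFinM lee_fin mulr_ge0// ltW.
- by apply: measurable_funeM; exact/measurable_EFinP.
- exact/measurable_EFinP.
- move=> w _; rewrite -EFinM lee_fin indicE.
  case: (boolP (w \in A)) => [|_]; last by rewrite mulr0.
  by rewrite inE mulr1.
Qed.

Context (n : nat) (Z : 'I_n -> {RV P >-> R}) (nu : probability R R).
Hypotheses (indepZ : mutually_independent Z) (lawZ : has_law Z nu).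

Lemma measurable_prod_coord (f : R -> R) (J : {set 'I_n}) :
  measurable_fun [set: R] f ->
  measurable_fun [set: n.-tuple R] (fun v => \prod_(i in J) f (tnth v i))%R.
Proof.
move=> mf; under eq_fun do rewrite big_mkcond/=.
apply: measurable_prod => i _; case: (i \in J) => //.
exact: measurableT_comp mf (measurable_tnth i).
Qed.

(** Integrating out one coordinate of J costs a factor at most K; induction on the size of J. *)
Lemma ge0_integral_prod_le (f : R -> R) (K : R) (J : {set 'I_n}) :
  measurable_fun [set: R] f -> (forall x, 0 <= f x)%R ->
  \int[nu]_x (f x)%:E <= K%:E ->
  \int[P]_w (\prod_(i in J) f (Z i w))%:E <= (K ^+ #|J|)%:E.
Proof.
move=> mf f0 fK; have K0 : (0 <= K)%R.
  by rewrite -lee_fin (le_trans _ fK)// integral_ge0// => x _; rewrite lee_fin.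
elim: {J}_.+1 {-2}J (ltnSn #|J|) => // k IHk J; rewrite ltnS => Jk.
case: (set_0Vmem J) => [->|[i iJ]].
  under eq_integral do rewrite big_set0.
  by rewrite integral_cst// cards0 expr0 mul1e probability_le1.
set G := fun w => (\prod_(j in J :\ i) f (Z j w))%R.
have G0 w : (0 <= G w)%R by apply: prodr_ge0.
have mG : measurable_fun [set: T] (fun w => (G w)%:E).
  apply/measurable_EFinP; rewrite /G.
  under eq_fun do under eq_bigr do rewrite -(tnth_vector Z).
  apply: measurableT_comp (measurable_prod_coord _ mf) _.
  exact: measurable_vector.
pose H (v : n.-tuple R) := (\prod_(j in J) f (tnth v j))%:E.
have -> : \int[P]_w (\prod_(j in J) f (Z j w))%:E = \int[P]_w H (vector Z w).
  apply: eq_integral => w _; congr _%:E.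
  by apply: eq_bigr => j _; rewrite (tnth_vector Z).
rewrite (ge0_integral_coord indepZ (nu := nu) (i := i)); last 3 first.
- by move=> A mA; rewrite -(lawZ i mA).
- by apply/measurable_EFinP; exact: measurable_prod_coord.
- by move=> v; rewrite lee_fin prodr_ge0.
have HE w : \int[nu]_x H (set_coord (vector Z w) i x) =
    (G w)%:E * \int[nu]_x (f x)%:E.
  rewrite -ge0_integralZl//.
  - apply: eq_integral => x _; rewrite -EFinM /H (big_setD1 i)//= mulrC.
    rewrite tnth_set_coord eqxx; congr (_ * _)%:E%R.
    apply: eq_bigr => j; rewrite !inE => /andP[ji _].
    by rewrite tnth_set_coord (negbTE ji) (tnth_vector Z).
  - exact/measurable_EFinP.
  - by move=> x _; rewrite lee_fin.
  - by rewrite lee_fin.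
under eq_integral do rewrite HE.
rewrite ge0_integralZr//; last 2 first.
- by move=> w _; rewrite lee_fin.
- by apply: integral_ge0 => x _; rewrite lee_fin.
rewrite [#|J|](cardsD1 i) iJ exprSr EFinM lee_pmul//.
- by apply: integral_ge0 => w _; rewrite lee_fin.
- by apply: integral_ge0 => x _; rewrite lee_fin.
- by apply: IHk; rewrite (cardsD1 i) iJ in Jk.
Qed.

Lemma chernoff_prod (f : R -> R) (K a : R) (J : {set 'I_n}) : (0 < a)%R ->
  measurable_fun [set: R] f -> (forall x, 0 <= f x)%R ->
  \int[nu]_x (f x)%:E <= K%:E ->
  P [set w | a <= \prod_(i in J) f (Z i w)]%R <= (K ^+ #|J| / a)%:E.
Proof.
move=> a0 mf f0 fK; apply: markov_ge0 => //.
- under eq_fun do under eq_bigr do rewrite -(tnth_vector Z).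
  apply: measurableT_comp (measurable_prod_coord _ mf) _.
  exact: measurable_vector.
- by move=> w; exact: prodr_ge0.
- exact: ge0_integral_prod_le.
Qed.

(** The parameter u may have either sign, so both tails are covered. *)
Lemma chernoff_sum (s u a : R) (J : {set 'I_n}) :
  (forall u : R,
    \int[nu]_x (expR (u * x))%:E <= (expR (s ^+ 2 * u ^+ 2 / 2))%:E) ->
  P [set w | a <= u * \sum_(i in J) Z i w]%R <=
    (expR (s ^+ 2 * u ^+ 2 / 2 * #|J|%:R - a))%:E.
Proof.
move=> subg.
have -> : [set w | a <= u * \sum_(i in J) Z i w]%R =
    [set w | expR a <= \prod_(i in J) expR (u * Z i w)]%R.
  by apply/seteqP; split=> w /=; rewrite -expR_sum -mulr_sumr ler_expR.
apply: (le_trans (chernoff_prod J (expR_gt0 a) _ _ (subg u))).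
- by apply: measurableT_comp => //; exact: measurable_funM.
- by move=> x; exact: expR_ge0.
- by rewrite -expRM_natr -expRN -expRD.
Qed.

Variables (B : set R) (q : R).
Hypotheses (mB : measurable B) (nuB : nu B = q%:E).

Let integral_expR_indic (t : R) :
  \int[nu]_x (expR (t * \1_B x))%:E <= (expR (q * (expR t - 1)))%:E.
Proof.
have q1 : (q <= 1)%R by rewrite -lee_fin -nuB probability_le1.
have -> : \int[nu]_x (expR (t * \1_B x))%:E =
    \int[nu]_x ((expR t)%:E * (\1_B x)%:E + (\1_(~` B) x)%:E).
  apply: eq_integral => x _; rewrite !indicE in_setC.
  case: (x \in B); last by rewrite mulr0 expR0 mule0 add0r.
  by rewrite mulr1 mule1 adde0.
have mnB : measurable (~` B) by exact: measurableC.
rewrite ge0_integralD//; last 2 first.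
- by apply: measurable_funeM; exact/measurable_EFinP.
- exact/measurable_EFinP.
rewrite ge0_integralZl//; last exact/measurable_EFinP.
have nuE A : measurable A -> \int[nu]_x (\1_A x)%:E = nu A.
  by move=> mA; rewrite integral_indic// setIT.
rewrite !nuE// probability_setC// nuB.
(* The moment equals 1 + q (e^t - 1), which is at most exp(q (e^t - 1)). *)
rewrite -EFinM -EFinB -EFinD lee_fin (le_trans _ (expR_ge1Dx _))//.
by lra.
Qed.

Let count_sum (J : {set 'I_n}) w :
  (#|[set i in J | Z i w \in B]|%:R = \sum_(i in J) \1_B (Z i w) :> R)%R.
Proof.
rewrite -sum1_card natr_sum big_mkcond/= [RHS]big_mkcond/=.
apply: eq_bigr => i _; rewrite inE indicE.
by case: (i \in J); case: (Z i w \in B).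
Qed.

Lemma ge0_integral_count_le (t : R) (J : {set 'I_n}) :
  \int[P]_w (expR (t * #|[set i in J | Z i w \in B]|%:R))%:E <=
  (expR (q * (expR t - 1) * #|J|%:R))%:E.
Proof.
under eq_integral do rewrite count_sum mulr_sumr expR_sum.
rewrite expRM_natr; apply: (@ge0_integral_prod_le (fun x => expR (t * \1_B x))).
- by apply: measurableT_comp => //; exact: measurable_funM.
- by move=> x; exact: expR_ge0.
- exact: integral_expR_indic.
Qed.

(** Chernoff bound at -u, with e^(-u) - 1 replaced by its upper bound -u + u^2 so that explicit
    values of u can be inserted later. *)
Lemma chernoff_count (u a : R) (J : {set 'I_n}) : (0 < u)%R -> (0 <= q)%R ->
  P [set w | #|[set i in J | Z i w \in B]|%:R <= a]%R <=
  (expR (u * a - q * (u - u ^+ 2) * #|J|%:R))%:E.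
Proof.
move=> u0 q0; have u0' := ltW u0.
have -> : [set w | #|[set i in J | Z i w \in B]|%:R <= a]%R =
    [set w | expR (- u * a) <= \prod_(i in J) expR (- u * \1_B (Z i w))]%R.
  apply/seteqP; split=> w /=;
    by rewrite -expR_sum ler_expR -mulr_sumr -count_sum !mulNr lerN2 ler_pM2l.
apply: (le_trans (chernoff_prod J (expR_gt0 _) _ _ (integral_expR_indic _))).
- by apply: measurableT_comp => //; exact: measurable_funM.
- by move=> x; exact: expR_ge0.
rewrite -expRM_natr -expRN -expRD lee_fin ler_expR.
(* Equivalent to (1 - u + u^2) e^u >= 1, which follows from e^u >= 1 + u and (1 - u + u^2) (1 + u) =
   1 + u^3. *)
have eu : (expR (- u) - 1 <= - (u - u ^+ 2))%R.
  have ue := expR_ge1Dx u; rewrite expRN lerBlDr -[(expR u)^-1%R]div1r.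
  rewrite ler_pdivrMr ?expR_gt0//.
  have : (0 <= (1 - u + u ^+ 2) * (expR u - (1 + u)))%R.
    by rewrite mulr_ge0// ?subr_ge0//; nra.
  have : (0 <= u ^+ 3)%R by rewrite exprn_ge0.
  nra.
have : (0 <= (- (u - u ^+ 2) - (expR (- u) - 1)) * (q * #|J|%:R))%R.
  by rewrite mulr_ge0// ?subr_ge0// mulr_ge0.
lra.
Qed.

End chernoff.

(** * Change of measure for Gaussian noise *)

Section gaussian_shift.
Context (R : realType) d (T : measurableType d) (P : probability T R) (n : nat).
Variables (Z : 'I_n -> {RV P >-> R}) (nu : probability R R) (s : R).
Hypotheses (indepZ : mutually_independent Z) (lawZ : has_law Z nu).
Hypotheses (s0 : s != 0)
  (nuE : forall A, measurable A -> nu A = normal_prob 0 s A).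
Local Open Scope ereal_scope.

Let lr (x : R) : R := (x / s ^+ 2 - (s ^+ 2)^-1 / 2)%R.

Definition shift_on (S : {set 'I_n}) (v : n.-tuple R) : n.-tuple R :=
  [tuple (tnth v j + (j \in S)%:R)%R | j < n].

Lemma tnth_shift_on S v j : tnth (shift_on S v) j = (tnth v j + (j \in S)%:R)%R.
Proof. by rewrite tnth_mktuple. Qed.

Lemma measurable_shift_on S : measurable_fun [set: n.-tuple R] (shift_on S).
Proof.
apply/measurable_fun_tnthP => j.
rewrite (_ : _ \o _ = fun v => (tnth v j + (j \in S)%:R)%R); last first.
  by apply/funext => v /=; rewrite tnth_shift_on.
by apply: measurable_funD => //; exact: measurable_tnth.
Qed.

Let measurable_lr : measurable_fun [set: R] lr.
Proof. by apply: measurable_funB => //; exact: measurable_funM. Qed.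

Let measurable_lr_sum (S : {set 'I_n}) :
  measurable_fun [set: n.-tuple R] (fun v => expR (\sum_(i in S) lr (tnth v i))).
Proof.
apply: measurableT_comp => //; under eq_fun do rewrite big_mkcond/=.
apply: measurable_sum => i; case: (i \in S) => //.
exact: measurableT_comp measurable_lr (measurable_tnth i).
Qed.

(** Cameron-Martin formula by induction on S: the shift of one coordinate i is hidden in F, the
    induction hypothesis removes the other shifts, and the one-dimensional formula then treats i. *)
Lemma ge0_integral_shift_on (S : {set 'I_n}) (F : n.-tuple R -> \bar R) :
  measurable_fun [set: n.-tuple R] F -> (forall v, 0 <= F v) ->
  \int[P]_w F (shift_on S (vector Z w)) =
  \int[P]_w (F (vector Z w) * (expR (\sum_(i in S) lr (Z i w)))%:E).
Proof.
elim: {S}_.+1 {-2}S (ltnSn #|S|) F => // k IHk S; rewrite ltnS => Sk F mF F0.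
case: (set_0Vmem S) => [->|[i iS]].
  apply: eq_integral => w _; rewrite big_set0 expR0 mule1; congr F.
  by apply: eq_from_tnth => j; rewrite tnth_shift_on inE addr0.
pose S' := S :\ i.
have S'k : (#|S'| < k)%N by rewrite (cardsD1 i) iS in Sk.
pose F1 v := F (shift_on [set i]%SET v).
have mF1 : measurable_fun [set: n.-tuple R] F1.
  by apply: measurableT_comp => //; exact: measurable_shift_on.
have -> : \int[P]_w F (shift_on S (vector Z w)) =
    \int[P]_w F1 (shift_on S' (vector Z w)).
  apply: eq_integral => w _; congr F; apply: eq_from_tnth => j.
  rewrite !tnth_shift_on !inE; case: eqVneq => [->|] /=.
    by rewrite iS addr0.
  by rewrite addr0.
rewrite (IHk S' S'k F1 mF1 (fun v => F0 _)).
pose H v := F v * (expR (\sum_(j in S') lr (tnth v j)))%:E.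
have mH : measurable_fun [set: n.-tuple R] H.
  apply: emeasurable_funM => //; apply/measurable_EFinP.
  exact: measurable_lr_sum.
have H0 v : 0 <= H v by rewrite mule_ge0// lee_fin expR_ge0.
pose H1 v := H (shift_on [set i]%SET v).
have mH1 : measurable_fun [set: n.-tuple R] H1.
  by apply: measurableT_comp => //; exact: measurable_shift_on.
pose H2 v := H v * (expR (lr (tnth v i)))%:E.
have mH2 : measurable_fun [set: n.-tuple R] H2.
  apply: emeasurable_funM => //; apply/measurable_EFinP.
  apply: measurableT_comp => //.
  exact: measurableT_comp measurable_lr (measurable_tnth i).
(* The factor accumulated over S' does not read coordinate i, so it is unchanged by the shift of
   i. *)
transitivity (\int[P]_w H1 (vector Z w)).
  apply: eq_integral => w _; congr (_ * (expR _)%:E).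
  apply: eq_bigr => j; rewrite !inE => /andP[ji _].
  by rewrite tnth_shift_on inE (negbTE ji) addr0 tnth_vector.
transitivity (\int[P]_w H2 (vector Z w)); last first.
  apply: eq_integral => w _; rewrite /H2/H -muleA -EFinM -expRD.
  congr (_ * (expR _)%:E); rewrite [RHS](big_setD1 i)//= [RHS]addrC tnth_vector.
  by congr (_ + _)%R; apply: eq_bigr => j _; rewrite tnth_vector.
have lawi A : measurable A -> P (Z i @^-1` A) = nu A.
  by move=> mA; rewrite -(lawZ i mA).
rewrite (ge0_integral_coord indepZ lawi mH1 (fun v => H0 _)).
have H20 v : 0 <= H2 v by rewrite mule_ge0// lee_fin expR_ge0.
rewrite (ge0_integral_coord indepZ lawi mH2 H20).
apply: eq_integral => w _.
pose h x := H (set_coord (vector Z w) i x).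
have mh : measurable_fun [set: R] h.
  apply: measurableT_comp => //.
  apply: (@measurableT_comp _ _ _ _ _ _ (fun vx => set_coord vx.1 i vx.2) _
    (fun x => (vector Z w, x))); first exact: measurable_set_coord.
  exact: measurable_fun_pair.
transitivity (\int[nu]_x h (x + 1)%R).
  apply: eq_integral => x _; rewrite /h /H1; congr H.
  apply: eq_from_tnth => j; rewrite tnth_shift_on !tnth_set_coord inE.
  by case: eqP => // _; rewrite addr0.
rewrite (ge0_integral_normal_shift s0 nuE mh (fun x => H0 _)).
by apply: eq_integral => x _; rewrite /H2 tnth_set_coord eqxx.
Qed.

Variable X : 'I_n -> {RV P >-> R}.
Hypothesis indepXZ : independent_vectors X Z.

Variables (G : set R) (mG : measurable G).

(* [tnth v i] stands for the design point X_i and [tnth z i] for the noise. *)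
Definition signal (v z : n.-tuple R) : n.-tuple R :=
  [tuple (\1_G (tnth v i) + tnth z i)%R | i < n].

(** Log-likelihood ratio of the signal on G against pure noise, given the design v, at the responses
    z. *)
Definition log_ratio (v z : n.-tuple R) : R :=
  (\sum_(i < n) \1_G (tnth v i) *
     (tnth z i / s ^+ 2 - (s ^+ 2)^-1 / 2))%R.

Let measurable_indicG i : measurable_fun [set: n.-tuple R * n.-tuple R]
  (fun vz => \1_G (tnth vz.1 i) : R).
Proof.
apply: measurableT_comp; first exact: measurable_indic.
exact: measurableT_comp (measurable_tnth i) measurable_fst.
Qed.

Lemma measurable_signal :
  measurable_fun [set: n.-tuple R * n.-tuple R] (fun vz => signal vz.1 vz.2).
Proof.
apply/measurable_fun_tnthP => i.
rewrite (_ : _ \o _ = fun vz => (\1_G (tnth vz.1 i) + tnth vz.2 i)%R).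
  apply: measurable_funD => //.
  exact: measurableT_comp (measurable_tnth i) measurable_snd.
by apply/funext => v /=; rewrite tnth_mktuple.
Qed.

Lemma measurable_log_ratio :
  measurable_fun [set: n.-tuple R * n.-tuple R]
    (fun vz => expR (log_ratio vz.1 vz.2)).
Proof.
apply: measurableT_comp => //; apply: measurable_sum => i.
apply: measurable_funM => //; apply: measurableT_comp measurable_lr _.
exact: measurableT_comp (measurable_tnth i) measurable_snd.
Qed.

(** Once the design is frozen by independence, G acts only through the fixed set of indices i with
    X_i in G, and adding the signal is a shift on that set. *)
Lemma ge0_integral_signal (F : n.-tuple R * n.-tuple R -> \bar R) :
  measurable_fun [set: n.-tuple R * n.-tuple R] F -> (forall v, 0 <= F v) ->
  \int[P]_w F (vector X w, signal (vector X w) (vector Z w)) =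
  \int[P]_w (F (vector X w, vector Z w) *
     (expR (log_ratio (vector X w) (vector Z w)))%:E).
Proof.
move=> mF F0.
pose VX : {mfun T >-> n.-tuple R} := mfun_Sub (mem_set (measurable_vector X)).
pose VZ : {mfun T >-> n.-tuple R} := mfun_Sub (mem_set (measurable_vector Z)).
have indepV A B : measurable A -> measurable B ->
    P ((VX @^-1` A) `&` (VZ @^-1` B)) = P (VX @^-1` A) * distribution P VZ B.
  exact: indepXZ.
pose F1 vz := F (vz.1, signal vz.1 vz.2).
pose F2 vz := F vz * (expR (log_ratio vz.1 vz.2))%:E.
have mF1 : measurable_fun [set: n.-tuple R * n.-tuple R] F1.
  apply: measurableT_comp => //; apply: measurable_fun_pair => //.
  exact: measurable_signal.
have mF2 : measurable_fun [set: n.-tuple R * n.-tuple R] F2.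
  apply: emeasurable_funM => //; apply/measurable_EFinP.
  exact: measurable_log_ratio.
have F20 vz : 0 <= F2 vz by rewrite mule_ge0// lee_fin expR_ge0.
transitivity (\int[P]_w F1 (VX w, VZ w)) => //.
transitivity (\int[P]_w F2 (VX w, VZ w)) => //.
rewrite (ge0_integral_indep indepV mF1 (fun vz => F0 _)).
rewrite (ge0_integral_indep indepV mF2 F20).
apply: eq_integral => w _; move: (VX w) => v.
have sec (H : n.-tuple R * n.-tuple R -> \bar R) :
    measurable_fun [set: n.-tuple R * n.-tuple R] H ->
    measurable_fun [set: n.-tuple R] (fun z => H (v, z)).
  by move=> mH; apply: measurableT_comp mH _; exact: measurable_fun_pair.
rewrite (ge0_integral_distribution _ (sec _ mF1) (fun z => F0 _)).
rewrite (ge0_integral_distribution _ (sec _ mF2) (fun z => F20 _)).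
pose S := [set i | tnth v i \in G]%SET.
transitivity (\int[P]_w F (v, shift_on S (vector Z w))).
  apply: eq_integral => w' _; rewrite /F1/=; congr (F (v, _)).
  apply: eq_from_tnth => i; rewrite tnth_shift_on !tnth_mktuple inE addrC.
  by rewrite indicE.
rewrite (ge0_integral_shift_on S (sec _ mF) (fun z => F0 _)).
apply: eq_integral => w' _; rewrite /F2/=; congr (_ * (expR _)%:E).
rewrite /log_ratio big_mkcond/=; apply: eq_bigr => i _.
by rewrite inE indicE tnth_vector; case: ifP; rewrite ?mul1r ?mul0r.
Qed.

End gaussian_shift.

(** * Designs *)

Section finite_events.
Context (R : realType) d (T : measurableType d).

Lemma measurable_mem (Z : {mfun T >-> R}) (A : set R) :
  measurable A -> measurable [set w | Z w \in A].
Proof.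
move=> mA; rewrite (_ : [set w | _] = Z @^-1` A).
  by rewrite -[X in measurable X]setTI; exact: measurable_funPT.
by apply/seteqP; split => w /=; rewrite inE.
Qed.

(** A random index set has finitely many values, so any event that it determines is a finite union
    of atoms. *)
Lemma measurable_pattern n (b : 'I_n -> T -> bool) (Q : {set 'I_n} -> Prop) :
  (forall i, measurable [set w | b i w]) ->
  measurable [set w | Q [set i | b i w]%SET].
Proof.
move=> mb.
rewrite (_ : [set w | _] = \bigcup_(S in Q) [set w | [set i | b i w]%SET = S]).
  apply: fin_bigcup_measurable => [|S _]; first exact: finite_finset.
  rewrite (_ : [set w | _] = \bigcap_(i in [set: 'I_n])
      (if i \in S then [set w | b i w] else ~` [set w | b i w])).
    apply: fin_bigcap_measurable => [|i _]; first exact: finite_finset.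
    by case: ifP => _ //; exact: measurableC.
  apply/seteqP; split => [w /= <- i _|w /= bS].
    rewrite inE; case: ifPn => //= /negP; exact.
  apply/setP => i; rewrite inE; have := bS i I.
  by case: (i \in S) => /= [|/negP/negbTE].
apply/seteqP; split => [w /= Qw|w [S QS /= ->]//].
by exists [set i | b i w]%SET.
Qed.

Lemma union_bound (P : {measure set T -> \bar R}) (I : choiceType) (s : seq I)
    (A : I -> set T) : (forall i, measurable (A i)) ->
  (P [set w | exists2 i, i \in s & A i w] <= \sum_(i <- s) P (A i))%E.
Proof.
move=> mA; have -> : [set w | exists2 i, i \in s & A i w] =
    \big[setU/set0]_(i <- s) A i.
  rewrite -bigcup_seq; apply/seteqP; split => w.
    by move=> [i si Aiw]; exists i.
  by move=> [i si Aiw]; exists i.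
elim: s => [|i s IHs]; first by rewrite !big_nil measure0.
rewrite !big_cons (le_trans (measureU2 _ _ _))//.
  by apply: bigsetU_measurable.
by rewrite leeD2l.
Qed.

End finite_events.

(** * Counting design points in a set *)

Section hits.
Context (R : realType).

Definition hits n (A : set R) (v : n.-tuple R) : nat :=
  #|[set i | tnth v i \in A]%SET|.

Lemma hits_count n (A : set R) (v : n.-tuple R) :
  hits A v = count (fun x => x \in A) v.
Proof.
rewrite /hits -sum1_card -sum1_count big_tuple.
by apply: eq_bigl => i; rewrite inE.
Qed.

(** Carries counts over from the sorted sample to the i.i.d. one. *)
Lemma hits_perm n (A : set R) (u v : n.-tuple R) :
  perm_eq u v -> hits A u = hits A v.
Proof. by move=> /seq.permP uv; rewrite !hits_count uv. Qed.

Lemma hits_sum n (A : set R) (v : n.-tuple R) :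
  (hits A v)%:R = \sum_(i < n) \1_A (tnth v i) :> R.
Proof.
rewrite /hits -sum1_card natr_sum big_mkcond/=.
by apply: eq_bigr => i _; rewrite inE indicE; case: (_ \in _).
Qed.

Lemma measurable_fun_hits n (A : set R) : measurable A ->
  measurable_fun [set: n.-tuple R] (fun v => (hits A v)%:R : R).
Proof.
move=> mA; under eq_fun do rewrite hits_sum.
apply: measurable_sum => i; apply: measurableT_comp (measurable_tnth i).
exact: measurable_indic.
Qed.

Lemma card_ltn_ord n m : (m <= n)%N -> #|[set i : 'I_n | (i < m)%N]%SET| = m.
Proof.
move=> mn; rewrite -sum1_card.
rewrite (eq_bigl (fun i : 'I_n => (i < m)%N)); last by move=> i; rewrite inE.
by rewrite (big_ord_narrow mn) sum1_card card_ord.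
Qed.

Lemma grid_hits n (v : n.-tuple R) (a b : R) : 0 <= a -> a <= b -> b <= 1 ->
  (forall i, tnth v i = i.+1%:R / n%:R) ->
  n%:R * (b - a) - 1 <= (hits `[a, b]%classic v)%:R <= n%:R * (b - a) + 2.
Proof.
move=> a0 ab b1 vE; have b0 := le_trans a0 ab.
have na0 : 0 <= n%:R * a by rewrite mulr_ge0.
have nb0 : 0 <= n%:R * b by rewrite mulr_ge0.
set A := [set i | tnth v i \in `[a, b]%classic]%SET.
have AE i : (i \in A) = (n%:R * a <= i.+1%:R) && (i.+1%:R <= n%:R * b).
  rewrite !inE vE mem_setE in_itv/=.
  have n0 : 0 < n%:R :> R by rewrite ltr0n (leq_ltn_trans _ (ltn_ord i)).
  by rewrite ler_pdivlMr// ler_pdivrMr// !(mulrC _ n%:R).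
(* The points are j / n with na <= j <= nb and j >= 1: there are K - c of them, plus one when na is
   a positive integer. The two roundings account for the - 1 and the + 2. *)
pose K := Num.truncn (n%:R * b); pose c := Num.truncn (n%:R * a).
have /andP[K1 K2] : K%:R <= n%:R * b < K.+1%:R by exact: truncn_itv.
have /andP[c1 c2] : c%:R <= n%:R * a < c.+1%:R by exact: truncn_itv.
have Kn : (K <= n)%N.
  by rewrite -(ler_nat R) (le_trans K1)// -[leRHS]mulr1 ler_wpM2l.
have cK : (c <= K)%N by rewrite truncn_ge_nat// (le_trans c1)// ler_wpM2l.
have AK i : i \in A -> (i < K)%N.
  by rewrite AE => /andP[_]; rewrite -truncn_ge_nat.
have cn := leq_trans cK Kn.
have low : (K <= #|A| + c)%N.
  rewrite -{1}(card_ltn_ord Kn) -{1}(card_ltn_ord cn).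
  rewrite (leq_trans _ (leq_card_setU _ _))// subset_leq_card//.
  apply/fintype.subsetP => i; rewrite finset.in_setU AE !inE => iK.
  have -> : i.+1%:R <= n%:R * b by rewrite -truncn_ge_nat.
  rewrite andbT orbC; case: ltnP => //= ci.
  by rewrite (le_trans (ltW c2))// ler_nat.
have upp : (#|A| + c.-1 <= K)%N.
  have c1n : (c.-1 <= n)%N by rewrite (leq_trans (leq_pred _)).
  rewrite -{1}(card_ltn_ord Kn) -{1}(card_ltn_ord c1n) -cardsUI.
  rewrite [X in (_ + X)%N](_ : _ = 0)%N ?addn0; last first.
    apply/eqP; rewrite cards_eq0; apply/eqP/setP => i.
    rewrite finset.in_setI AE finset.in_set0 inE; apply/negbTE/negP.
    move=> /andP[/andP[+ _]].
    case: (c) c1 => // c' /= c'1 + ic'.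
    by rewrite leNgt (lt_le_trans _ c'1)// ltr_nat.
  apply/subset_leq_card/fintype.subsetP => i.
  rewrite finset.in_setU => /orP[/AK|]; rewrite !inE//.
  move=> ic; apply: leq_trans cK; apply: leq_trans ic _; exact: leq_pred.
have lowR : K%:R <= #|A|%:R + c%:R :> R by rewrite -natrD ler_nat.
have uppR : #|A|%:R + c%:R <= K%:R + 1 :> R.
  rewrite -natrD -[1]/(1%:R) -natrD ler_nat addn1 -ltnS.
  by case: (c) upp => [|c'] /=; lia.
rewrite /hits -/A; apply/andP; split; rewrite -natr1 in K2 c2; lra.
Qed.

End hits.

Section uniform01.
Context (R : realType).

Lemma uniform_prob01E (U : set R) : measurable U ->
  uniform_prob (@ltr01 R) U = lebesgue_measure (U `&` `[0, 1]%classic).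
Proof.
move=> mU; rewrite /uniform_prob integral_uniform_pdf.
have mU1 : measurable (U `&` `[0, 1]%classic : set R) by exact: measurableI.
rewrite (eq_integral (fun=> 1%E)).
  by rewrite integral_cst// mul1e.
move=> x; rewrite inE/= in_itv/= => -[_ x01].
by rewrite /uniform_pdf x01 subr0 invr1.
Qed.

Lemma uniform_prob01_itv (a b : R) : 0 <= a -> a <= b -> b <= 1 ->
  uniform_prob (@ltr01 R) `[a, b]%classic = (b - a)%:E.
Proof.
move=> a0 ab b1; rewrite uniform_prob01E//.
rewrite (_ : _ `&` _ = `[a, b]%classic); last first.
  apply: setIidl => x /=; rewrite !in_itv/= => /andP[ax xb].
  by rewrite (le_trans a0)//= (le_trans xb).
rewrite lebesgue_measure_itv/= lte_fin -EFinB.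
by case: ltP => // ba; rewrite (@le_anti _ _ a b) ?ab// subrr.
Qed.

Lemma uniform_prob01_le (h : R) : 0 <= h -> h <= 1 ->
  uniform_prob (@ltr01 R) `]-oo, h]%classic = h%:E.
Proof.
move=> h0 h1; rewrite uniform_prob01E//.
rewrite (_ : _ `&` _ = `[0, h]%classic); last first.
  apply/seteqP; split => x /=; rewrite !in_itv/=.
    by move=> [xh /andP[-> _]].
  by move=> /andP[-> xh]; rewrite xh (le_trans xh).
rewrite lebesgue_measure_itv/= lte_fin oppr0 adde0.
by case: ltP => // h0'; rewrite (@le_anti _ _ h 0) ?h0 ?h0'.
Qed.

(** The uniform law as a probability on [R] itself, so that it can serve as the common law in the
    Chernoff bounds. *)
Definition uniform01 : probability R R :=
  distribution (uniform_prob (@ltr01 R)) (mfun_Sub (mem_set (@measurable_idR R))).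

End uniform01.

Lemma hits_vector (R : realType) d (T : measurableType d) (P : probability T R)
    n (Z : 'I_n -> {RV P >-> R}) (A : set R) w :
  hits A (vector Z w) = #|[set i | Z i w \in A]%SET|.
Proof. by apply: eq_card => i; rewrite !inE tnth_vector. Qed.

Section design_facts.
Context (R : realType) d (T : measurableType d) (P : probability T R).
Context (n : nat) (D : design) (X : 'I_n -> {RV P >-> R}).
Hypothesis designX : follows_design D X.

Lemma design_sorted w (i j : 'I_n) : (i <= j)%N -> X i w <= X j w.
Proof.
case: D designX => [/= XE|[U [_ _ XU]]] ij.
  by rewrite !XE ler_pM2r ?ler_nat// invr_gt0 ltr0n (leq_ltn_trans _ (ltn_ord i)).
rewrite -!(tnth_vector X) !(tnth_nth 0) XU.
apply: (sorted_leq_nth le_trans lexx) => //; rewrite ?inE ?size_sort ?size_tuple//.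
exact: (sort_sorted le_total).
Qed.

Lemma measurable_hits A (Q : nat -> Prop) : measurable A ->
  measurable [set w | Q (hits A (vector X w))].
Proof.
move=> mA; have := @measurable_pattern _ _ n (fun i w => X i w \in A)
  (fun S => Q #|S|) (fun i => measurable_mem (X i) mA).
by congr measurable; apply/seteqP; split => w /=; rewrite hits_vector.
Qed.

Lemma hits_lower_tail (a b : R) : 0 <= a -> a <= b -> b <= 1 ->
  2 <= n%:R * (b - a) ->
  (P [set w | (hits `[a, b]%classic (vector X w))%:R <= n%:R * (b - a) / 4]%R <=
   (expR (- (n%:R * (b - a) / 8)))%:E)%E.
Proof.
move=> a0 ab b1 nq; case: D designX => [/= XE|[U [indepU lawU XU]]].
  (* On the grid the count is at least n (b - a) - 1, which exceeds n (b - a) / 4 as soon as n (b -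
     a) >= 2. *)
  rewrite (_ : [set w | _] = set0) ?measure0 ?lee_fin ?expR_ge0//.
  apply/seteqP; split => w //=.
  have /andP[+ _] := @grid_hits R n (vector X w) a b a0 ab b1
    (fun i => etrans (tnth_vector X w i) (XE i w)).
  by move=> ? ?; lra.
have -> : [set w | (hits `[a, b]%classic (vector X w))%:R <= n%:R * (b - a) / 4] =
  [set w | #|[set i in [set: 'I_n] | U i w \in `[a, b]%classic]%SET|%:R <=
     n%:R * (b - a) / 4].
  have hE w : hits `[a, b]%classic (vector X w) =
      #|[set i in [set: 'I_n] | U i w \in `[a, b]%classic]%SET|.
    rewrite (@hits_perm _ _ _ _ (vector U w)) ?XU ?perm_sort// hits_vector.
    by apply: eq_card => i; rewrite !inE.
  by apply/seteqP; split => w /=; rewrite hE.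
have lawU' : has_law U (uniform01 R) by exact: lawU.
have q0 : 0 <= b - a by rewrite subr_ge0.
(* With u = 1/2 and q = b - a the exponent is nq / 8 - nq / 4 = - nq / 8. *)
have u0 : 0 < 1 / 2 :> R by lra.
have mab : measurable (`[a, b]%classic : set R) by [].
apply: le_trans (chernoff_count indepU lawU' mab (uniform_prob01_itv a0 ab b1)
  _ _ u0 q0) _.
rewrite lee_fin ler_expR cardsT card_ord; lra.
Qed.

(** The shape is the Poisson-type moment bound of the random design; the + 2 and t <= e^t - 1 make
    it hold for the grid too. *)
Lemma ge0_integral_hits_le (a b t : R) : 0 <= a -> a <= b -> b <= 1 -> 0 <= t ->
  (\int[P]_w (expR (t * (hits `[a, b]%classic (vector X w))%:R))%:E <=
   (expR ((n%:R * (b - a) + 2) * (expR t - 1)))%:E)%E.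
Proof.
move=> a0 ab b1 t0.
have q0 : 0 <= b - a by rewrite subr_ge0.
have et : t <= expR t - 1 by rewrite lerBrDl expR_ge1Dx.
have et0 := le_trans t0 et.
have mab : measurable (`[a, b]%classic : set R) by [].
have mh : measurable_fun [set: T]
    (fun w => (hits `[a, b]%classic (vector X w))%:R : R).
  exact: (measurableT_comp (measurable_fun_hits mab) (measurable_vector X)).
case: D designX => [/= XE|[U [indepU lawU XU]]].
  apply: (@le_trans _ _
    (\int[P]_w (expR ((n%:R * (b - a) + 2) * (expR t - 1)))%:E)%E).
    apply: ge0_le_integral => //=.
    - apply/measurable_EFinP; apply: (measurableT_comp (@measurable_expR R)).
      exact: (measurable_funM (measurable_cst t) mh).
    - move=> w _; rewrite lee_fin ler_expR mulrC ler_pM//.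
      have /andP[_ //] := @grid_hits R n (vector X w) a b a0 ab b1
        (fun i => etrans (tnth_vector X w i) (XE i w)).
  by rewrite integral_cst// -[leRHS]mule1 lee_wpmul2l ?probability_le1.
under eq_integral.
  move=> w _; rewrite (_ : hits _ _ =
      #|[set i in [set: 'I_n] | U i w \in `[a, b]%classic]%SET|); last first.
    rewrite (@hits_perm _ _ _ _ (vector U w)) ?XU ?perm_sort// hits_vector.
    by apply: eq_card => i; rewrite !inE.
  over.
have lawU' : has_law U (uniform01 R) by exact: lawU.
apply: le_trans (ge0_integral_count_le indepU lawU' mab
  (uniform_prob01_itv a0 ab b1) _ _) _.
rewrite lee_fin ler_expR cardsT card_ord.
by have := mulr_ge0 et0 (ler0n R 2); lra.
Qed.

Lemma design_hit_le (h : R) : 0 <= h -> h <= 1 -> n%:R * h < 1 ->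
  (P [set w | exists i, X i w <= h]%R <= (n%:R * h)%:E)%E.
Proof.
move=> h0 h1 nh1; case: D designX => [/= XE|[U [indepU lawU XU]]].
  rewrite (_ : [set w | _] = set0) ?measure0 ?lee_fin ?mulr_ge0//.
  apply/seteqP; split => w //= -[i]; rewrite XE.
  have n0 : 0 < n%:R :> R by rewrite ltr0n (leq_ltn_trans _ (ltn_ord i)).
  rewrite ler_pdivrMr// mulrC leNgt (lt_le_trans nh1)//.
  by rewrite -[1]/(1%:R) ler_nat.
(* Having a point below h does not depend on the order, so the union bound can be taken over the
   unsorted sample. *)
have -> : [set w | exists i, X i w <= h] =
    [set w | exists2 i, i \in enum 'I_n & (U i @^-1` `]-oo, h]) w].
  apply/seteqP; split => w /= [i].
    rewrite -(tnth_vector X) => Xi.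
    have : tnth (vector X w) i \in (vector U w : seq R).
      by rewrite -(mem_sort <=%R) -XU mem_tnth.
    move=> /tnthP[j UX]; exists j; first by rewrite mem_enum.
    by rewrite in_itv/= -(tnth_vector U) -UX.
  rewrite in_itv/= => _ Ui.
  have : tnth (vector U w) i \in (vector X w : seq R).
    by rewrite XU mem_sort mem_tnth.
  by move=> /tnthP[j UX]; exists j; rewrite -(tnth_vector X) -UX tnth_vector.
apply: le_trans (union_bound _ _ _) _.
  by move=> i; rewrite -[X in measurable X]setTI; exact: measurable_funPT.
rewrite (eq_bigr (fun=> h%:E)); last first.
  by move=> i _; rewrite -(uniform_prob01_le h0 h1); exact: lawU.
by rewrite sumEFin big_const_seq iter_addr_0 count_predT size_enum_ord mulr_natl.
Qed.

End design_facts.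

(** * Measurability of the tests *)

Section observations.
Context (R : realType) (n : nat).

Definition obs_of (v y : n.-tuple R) : obs R n :=
  [tuple (tnth v i, tnth y i) | i < n].

Lemma measurable_obs_of :
  measurable_fun [set: n.-tuple R * n.-tuple R] (fun vy => obs_of vy.1 vy.2).
Proof.
apply/measurable_fun_tnthP => i.
rewrite (_ : _ \o _ = fun vy => (tnth vy.1 i, tnth vy.2 i)).
  apply: measurable_fun_pair.
    exact: measurableT_comp (measurable_tnth i) measurable_fst.
  exact: measurableT_comp (measurable_tnth i) measurable_snd.
by apply/funext => v /=; rewrite tnth_mktuple.
Qed.

Lemma measurable_Xs i : measurable_fun [set: obs R n] (fun z => Xs z i).
Proof. exact: measurableT_comp measurable_fst (measurable_tnth i). Qed.

Lemma measurable_Ys i : measurable_fun [set: obs R n] (fun z => Ys z i).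
Proof. exact: measurableT_comp measurable_snd (measurable_tnth i). Qed.

Lemma measurable_fun_boolT (tau : obs R n -> bool) :
  measurable [set z | tau z] -> measurable_fun [set: obs R n] tau.
Proof.
move=> mtau; apply: (measurable_fun_bool true); rewrite setTI.
by rewrite (_ : _ @^-1` _ = [set z | tau z]).
Qed.

Lemma measurable_T0 (c : R) (h : nat -> R) :
  measurable_fun [set: obs R n] (@T0 R c h n).
Proof.
apply: measurable_fun_boolT.
(* [S_stat] counts over a random range; on the event N = m the range is fixed, so the rejection
   region splits according to m. *)
pose A m := [set z : obs R n | (m = N_stat (h n) z)%N].
pose B m := [set z : obs R n |
  #|[set i : 'I_n | (i < m)%N && (Ys z i <= 1 / 2)]%SET|%:R <= c * m%:R].
rewrite (_ : [set z | _] = \bigcup_m (A m `&` B m)); last first.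
  apply/seteqP; split => z /=; first by exists (N_stat (h n) z).
  by move=> [m _ [-> ]].
apply: bigcupT_measurable => m; apply: measurableI.
- apply: (measurable_pattern (b := fun i z => Xs z i <= h n)
    (fun S => m = #|S|)) => i.
  rewrite -[X in measurable X]setTI; have := measurable_Xs i.
  move=> /(_ measurableT `]-oo, h n]%classic).
  rewrite (_ : _ @^-1` _ = [set w | Xs w i <= h n]).
    by apply.
  by apply/seteqP; split => z; rewrite /= in_itv.
- apply: (measurable_pattern (b := fun i z => (i < m)%N && (Ys z i <= 1 / 2))
    (fun S => #|S|%:R <= c * m%:R)) => i.
  case: (i < m)%N => /=; last first.
    by rewrite (_ : [set w | _] = set0)//; apply/seteqP; split.
  rewrite -[X in measurable X]setTI; have := measurable_Ys i.
  move=> /(_ measurableT `]-oo, (1 / 2)]%classic).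
  rewrite (_ : _ @^-1` _ = [set w | Ys w i <= 1 / 2]).
    by apply.
  by apply/seteqP; split => z; rewrite /= in_itv.
Qed.

Lemma R_scoreE (z : obs R n) (G : set R) :
  R_score z G = \sum_(i < n) (Ys z i - 1 / 2) * \1_G (Xs z i).
Proof.
rewrite /R_score (_ : #|_|%:R = \sum_(i < n) \1_G (Xs z i)); last first.
  rewrite -sum1_card natr_sum big_mkcond/=.
  by apply: eq_bigr => i _; rewrite inE indicE; case: (_ \in _).
rewrite mulr_sumr -sumrB; apply: eq_bigr => i _; ring.
Qed.

Lemma measurable_R_score (G : set R) : measurable G ->
  measurable_fun [set: obs R n] (fun z => R_score z G).
Proof.
move=> mG; under eq_fun do rewrite R_scoreE.
apply: measurable_sum => i; apply: measurable_funM.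
  by apply: measurable_funB => //; exact: measurable_Ys.
apply: measurableT_comp (measurable_Xs i); exact: measurable_indic.
Qed.

Lemma long_itv (h a b : R) : 0 < h -> long h `[a, b]%classic -> h <= b - a.
Proof.
move=> h0; rewrite /long/= lebesgue_measure_itv/= lte_fin.
by case: ltP => _; rewrite lee_fin// leNgt h0.
Qed.

Lemma itv_long (h a b : R) : 0 < h -> h <= b - a -> long h `[a, b]%classic.
Proof.
move=> h0 hab; rewrite /long/= lebesgue_measure_itv/= lte_fin.
by rewrite -subr_gt0 (lt_le_trans h0 hab) -EFinB lee_fin.
Qed.

Definition rat_segment (q : rat * rat) : set R := `[ratr q.1, ratr q.2]%classic.

(* Moving the endpoints outwards to rational ones keeps a segment long, so the
   supremum in [R_stat] may be taken over countably many segments. *)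
Lemma rat_segment_ex (z : obs R n) (a b : R) : 0 <= a -> a <= b -> b <= 1 ->
  exists q : rat * rat, [/\ 0 <= ratr q.1 :> R, ratr q.1 <= a,
    b <= ratr q.2, ratr q.2 <= 1 :> R &
    forall i, (Xs z i \in `[a, b]%classic) = (Xs z i \in rat_segment q)].
Proof.
move=> a0 ab b1.
have [q1 [q10 q1a q1X]] : exists q1 : rat, [/\ 0 <= ratr q1 :> R, ratr q1 <= a &
    forall i, Xs z i < a -> Xs z i < ratr q1].
  have [->|a_neq0] := eqVneq a 0.
    by exists 0; rewrite rmorph0; split.
  have a_gt0 : 0 < a by rewrite lt_def a_neq0.
  (* A rational q between a and the largest design point below a adds no design point to the
     segment; the default value 0 keeps q nonnegative. *)
  pose m := \big[Num.max/0]_(i < n | Xs z i < a) Xs z i.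
  have ma : m < a by rewrite /m; elim/big_ind: _ => // x y; rewrite gt_max => -> ->.
  have [q] := rat_in_itvoo ma; rewrite in_itv/= => /andP[mq qa].
  exists q; split; last 2 first.
  - exact: ltW.
  - by move=> i Xa; rewrite (le_lt_trans _ mq)// /m (bigD1 i)//= le_max lexx.
  - apply: ltW; apply: le_lt_trans mq; rewrite /m.
    by elim/big_rec: _ => // i x _ x0; rewrite le_max x0 orbT.
have [q2 [q21 q2b q2X]] : exists q2 : rat, [/\ ratr q2 <= 1 :> R, b <= ratr q2 &
    forall i, b < Xs z i -> ratr q2 < Xs z i].
  have [->|b_neq1] := eqVneq b 1.
    by exists 1; rewrite rmorph1; split.
  have b_lt1 : b < 1 by rewrite lt_def eq_sym b_neq1.
  pose m := \big[Num.min/1]_(i < n | b < Xs z i) Xs z i.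
  have bm : b < m by rewrite /m; elim/big_ind: _ => // x y; rewrite lt_min => -> ->.
  have [q] := rat_in_itvoo bm; rewrite in_itv/= => /andP[bq qm].
  exists q; split; last 2 first.
  - exact: ltW.
  - by move=> i bX; rewrite (lt_le_trans qm)// /m (bigD1 i)//= ge_min lexx.
  - apply: ltW; apply: lt_le_trans qm _; rewrite /m.
    by elim/big_rec: _ => // i x _ x0; rewrite ge_min x0 orbT.
exists (q1, q2); split => // i; rewrite !mem_setE !in_itv/=; congr andb.
  apply/idP/idP => [|q1x]; first exact: le_trans.
  by rewrite leNgt; apply/negP => /q1X; rewrite ltNge q1x.
apply/idP/idP => [xb|xq2]; first exact: le_trans xb _.
by rewrite leNgt; apply/negP => /q2X; rewrite ltNge xq2.
Qed.

Lemma measurable_T1 (h : nat -> R) : (forall n, 0 < h n) ->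
  measurable_fun [set: obs R n] (@T1 R h n).
Proof.
move=> h0; apply: measurable_fun_boolT.
pose V := [set q : rat * rat | [/\ 0 <= ratr q.1 :> R, ratr q.2 <= 1 :> R &
  h n <= ratr q.2 - ratr q.1]].
(* The slack 1 / (k + 1) expresses that the supremum is nonnegative without assuming that it is
   attained. *)
pose A k q := [set z : obs R n | - k.+1%:R^-1 < R_score z (rat_segment q)].
rewrite (_ : [set z | _] = \bigcap_k \bigcup_(q in V) A k q); last first.
  apply/seteqP; split => z /=.
    move=> Rz k _; apply: contrapT => nA.
    suff : (R_stat (h n) z <= (- k.+1%:R^-1)%:E)%E.
      by move=> /(le_trans Rz); rewrite lee_fin oppr_ge0 leNgt invr_gt0 ltr0n.
    apply: ge_ereal_sup => _ [G [[a [b [a0 ab b1 ->]]] lG] <-].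
    have [q [q1 q2 q3 q4 qX]] := rat_segment_ex z a0 ab b1.
    rewrite lee_fin leNgt; apply/negP => ltG; apply: nA; exists q.
      split => //; have := long_itv (h0 n) lG => hab; lra.
    rewrite /A/= !R_scoreE in ltG *.
    under eq_bigr do rewrite indicE -qX -indicE.
    exact: ltG.
  move=> Az; apply/lee_addgt0Pr => e e0.
  have [k ke] : exists k : nat, k.+1%:R^-1 <= e.
    exists (Num.truncn e^-1); rewrite invf_ple ?posrE//.
    by rewrite ltW// truncnS_gt.
  have [q [q1 q2 q3] Aq] := Az k I.
  have : ((R_score z (rat_segment q))%:E <= R_stat (h n) z)%E.
    apply: ereal_sup_ubound; exists (rat_segment q) => //; split.
      exists (ratr q.1), (ratr q.2); split => //.
      have := h0 n; move: q3 => /=; lra.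
    exact: itv_long.
  move=> /(leeD2r e%:E); apply: le_trans.
  rewrite -EFinD lee_fin -lerBlDr sub0r; apply: le_trans (ltW Aq).
  by rewrite lerN2.
apply: bigcapT_measurable => k; rewrite bigcup_mkcond.
apply: countable_bigcupT_measurable => // q.
case: ifP => _ //; rewrite -[A k q]setTI.
rewrite (_ : A k q = (fun z => R_score z (rat_segment q)) @^-1`
    `]- k.+1%:R^-1, +oo[%classic); last first.
  by apply/seteqP; split => z; rewrite /A/= in_itv/= andbT.
have mq : measurable (rat_segment q) by exact: measurable_itv.
exact: (measurable_R_score mq).
Qed.

End observations.

(** * Upper bounds on the risk *)

Section experiments.
Context (R : realType) (D : design) (mu : probability R R) (n : nat).
Variable E : experiment D mu n.
Local Notation P := (Prob E).
Local Notation X := (dpoint E).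
Local Notation Z := (noise E).

Lemma observeE (G : set R) w :
  observe (E := E) G w =
  obs_of (vector X w) (signal G (vector X w) (vector Z w)).
Proof. by apply: eq_from_tnth => i; rewrite !tnth_mktuple. Qed.

Lemma observe0E w : observe (E := E) set0 w = obs_of (vector X w) (vector Z w).
Proof.
rewrite observeE; congr obs_of; apply: eq_from_tnth => i.
by rewrite tnth_mktuple indic0 add0r.
Qed.

Lemma Xs_observe (G : set R) w i : Xs (observe (E := E) G w) i = X i w.
Proof. by rewrite /Xs tnth_mktuple. Qed.

Lemma Ys_observe (G : set R) w i :
  Ys (observe (E := E) G w) i = \1_G (X i w) + Z i w.
Proof. by rewrite /Ys tnth_mktuple. Qed.

Lemma measurable_observe (G : set R) : measurable G ->
  measurable_fun [set: Omega E] (observe (E := E) G).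
Proof.
move=> mG; rewrite (funext (observeE G)).
have mXZ := measurable_fun_pair (measurable_vector X) (measurable_vector Z).
have ms := measurableT_comp (measurable_signal mG) mXZ.
exact: (measurableT_comp (@measurable_obs_of R n)
  (measurable_fun_pair (measurable_vector X) ms)).
Qed.

Lemma measurable_dpoint_le (h : R) : measurable [set w | exists i, X i w <= h].
Proof.
rewrite (_ : [set w | _] = \bigcup_(i in [set: 'I_n]) (X i @^-1` `]-oo, h])).
  apply: fin_bigcup_measurable => [|i _]; first exact: finite_finset.
  by rewrite -[X in measurable X]setTI; exact: measurable_funPT.
by apply/seteqP; split => w /= [i]; [exists i => //|];
  rewrite /= ?in_itv//= => _ Xi; exists i.
Qed.

Lemma measurable_observe_test (G : set R) (tau : obs R n -> bool) (b : bool) :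
  measurable G -> measurable_fun [set: obs R n] tau ->
  measurable [set w | tau (observe (E := E) G w) = b].
Proof.
move=> mG mtau.
have := measurableT_comp mtau (measurable_observe mG).
by move=> /(_ measurableT [set b] I); rewrite setTI.
Qed.

Lemma gamma_le (C : set (set R)) (h : R) (tau : obs R n -> bool) (e1 e2 : \bar R) :
  (0 <= e2)%E ->
  (P [set w | tau (observe (E := E) set0 w)] <= e1)%E ->
  (forall G, C G -> long h G ->
    (P [set w | ~~ tau (observe (E := E) G w)] <= e2)%E) ->
  (gamma E C h tau <= e1 + e2)%E.
Proof.
move=> e20 H0 H1; rewrite /gamma leeD//.
by apply: ge_ereal_sup => _ [->//|[G [CG lG] <-]]; exact: H1.
Qed.

Lemma gamma_ge (C : set (set R)) (h : R) (tau : obs R n -> bool) (G : set R) :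
  C G -> long h G ->
  (P [set w | tau (observe (E := E) set0 w)] +
   P [set w | ~~ tau (observe (E := E) G w)] <= gamma E C h tau)%E.
Proof.
move=> CG lG; rewrite /gamma leeD//; apply: ereal_sup_ubound.
by right; exists G.
Qed.

Lemma gamma_ge0 (C : set (set R)) (h : R) (tau : obs R n -> bool) :
  (0 <= gamma E C h tau)%E.
Proof.
apply: adde_ge0; last by apply: ereal_sup_ubound; left.
by rewrite /P_ /pushforward measure_ge0.
Qed.

End experiments.

(** For a sorted design, this turns threshold events on the points into initial ranges of
    indices. *)
Lemma ord_down_closed n (p : pred 'I_n) :
  (forall i j : 'I_n, (i <= j)%N -> p j -> p i) ->
  forall i, p i = (i < #|[set i | p i]%SET|)%N.
Proof.
move=> pd i; have [pi|npi] := boolP (p i); apply/esym.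
  rewrite -{1}[i.+1](card_ltn_ord (ltn_ord i)); apply/subset_leq_card.
  by apply/fintype.subsetP => j; rewrite !inE => ji; exact: pd pi.
apply/negbTE; rewrite -leqNgt -{1}[nat_of_ord i](card_ltn_ord (ltnW (ltn_ord i))).
apply/subset_leq_card/fintype.subsetP => j; rewrite !inE => pj.
by rewrite ltnNge; apply: contra npi => ij; exact: pd pj.
Qed.

(** Gives up exponential decay so that the risk bound of [T0] takes the simple form constant / x. *)
Lemma expRN_le_inv (R : realType) (x : R) : 0 < x -> expR (- x) <= x^-1.
Proof.
move=> x0; rewrite expRN lef_pV2 ?posrE ?expR_gt0//.
by apply: le_trans (expR_ge1Dx x); rewrite lerDr.
Qed.

(** * Risk of [T0] on segments starting at 0 *)

Section T0_bound.
Context (R : realType) (D : design) (mu : probability R R) (n : nat).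
Variable E : experiment D mu n.
Local Notation P := (Prob E).
Local Notation X := (dpoint E).
Local Notation Z := (noise E).

(* The Chernoff bounds of the prefixes of length k >= m sum geometrically. *)
Lemma prefix_count_lower_tail (B : set R) (p c : R) (m : nat) :
  measurable B -> mu B = p%:E -> c < p ->
  (P [set w | exists k, [/\ (m <= k)%N, (k <= n)%N &
       #|[set i : 'I_n | (i < k)%N && (Z i w \in B)]%SET|%:R <= c * k%:R]%R]
   <= (expR (- ((p - c) ^+ 2 / 4 * m%:R)) /
       (1 - expR (- ((p - c) ^+ 2 / 4))))%:E)%E.
Proof.
move=> mB muB cp; set r := expR (- ((p - c) ^+ 2 / 4)).
have r0 : 0 < r by exact: expR_gt0.
have r1 : r < 1 by rewrite /r expR_lt1 oppr_lt0 divr_gt0// exprn_gt0// subr_gt0.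
pose A k := [set w |
  #|[set i : 'I_n | (i < k)%N && (Z i w \in B)]%SET|%:R <= c * k%:R].
have mA k : measurable (A k).
  apply: (measurable_pattern (b := fun i w => (i < k)%N && (Z i w \in B))
    (fun S => #|S|%:R <= c * k%:R)) => i.
  case: (i < k)%N => /=; first exact: measurable_mem.
  by rewrite (_ : [set w | _] = set0)//; apply/seteqP; split.
rewrite (_ : [set w | _] =
    [set w | exists2 k, k \in index_iota m n.+1 & A k w]); last first.
  apply/seteqP; split => w /=.
    by move=> [k [mk kn Ak]]; exists k => //; rewrite mem_index_iota mk ltnS.
  by move=> [k]; rewrite mem_index_iota ltnS => /andP[mk kn] Ak; exists k.
apply: (le_trans (union_bound _ _ mA)).
have PA k : (k <= n)%N -> (P (A k) <= (r ^+ k)%:E)%E.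
  move=> kn; have p0 : 0 <= p by rewrite -lee_fin -muB measure_ge0.
  have p1 : p <= 1 by rewrite -lee_fin -muB probability_le1.
  (* For this u the exponent per index is - (p - c)^2 / 2 + p (p - c)^2 / 4, at most - (p - c)^2 / 4
     because p <= 1. *)
  have u0 : 0 < (p - c) / 2 by lra.
  have := chernoff_count (@noise_indep _ _ _ _ E) (@noise_law _ _ _ _ E) mB muB
    (c * k%:R) [set i : 'I_n | (i < k)%N]%SET u0 p0.
  rewrite (_ : [set w | _] = A k); last first.
    apply/seteqP; split => w; rewrite /A/=; congr (_%:R <= _); apply: eq_card => i;
      by rewrite !inE.
  move=> /le_trans; apply; rewrite card_ltn_ord// lee_fin /r -expRM_natr ler_expR.
  have k0 : 0 <= k%:R :> R by [].
  have : 0 <= (1 - p) * ((p - c) ^+ 2 * k%:R).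
    by rewrite mulr_ge0 ?subr_ge0// mulr_ge0// sqr_ge0.
  lra.
apply: (@le_trans _ _ (\sum_(m <= k < n.+1) (r ^+ k)%:E)%E).
  rewrite big_seq [leRHS]big_seq; apply: lee_sum => k.
  by rewrite mem_index_iota ltnS => /andP[_ kn]; exact: PA.
rewrite sumEFin lee_fin -mulNr expRM_natr -/r ler_pdivlMr ?subr_gt0//.
have [mn|nm] := leqP m n.+1; last first.
  by rewrite big_geq ?mul0r ?exprn_ge0 ?(ltW r0)// ltnW.
rewrite mulr_suml.
rewrite (eq_bigr (fun k => - (r ^+ k.+1 - r ^+ k))); last first.
  by move=> k _; rewrite exprS; ring.
rewrite sumrN telescope_sumr// opprB lerBlDr lerDl exprn_ge0//.
exact: ltW.
Qed.

End T0_bound.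

Lemma measure_subU2 (R : realType) d (T : measurableType d)
    (P : {measure set T -> \bar R}) (A B C : set T) (b c : \bar R) :
  measurable A -> measurable B -> measurable C -> A `<=` B `|` C ->
  (P B <= b)%E -> (P C <= c)%E -> (P A <= b + c)%E.
Proof.
move=> mA mB mC ABC Bb Cc; apply: (@le_trans _ _ (P (B `|` C))).
  by apply: le_measure => //; rewrite inE//; exact: measurableU.
by apply: le_trans (measureU2 _ mB mC) _; exact: leeD.
Qed.

Section T0_consistency_bound.
Context (R : realType) (D : design) (mu : probability R R) (n : nat).
Variable E : experiment D mu n.
Local Notation P := (Prob E).
Local Notation X := (dpoint E).
Local Notation Z := (noise E).

(** The factor 32 / delta^2 comes from exp(- delta^2 x / 32) <= 32 / (delta^2 x), the other factor
    from the geometric series. *)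
Definition T0_rate (delta : R) : R :=
  32 / delta ^+ 2 / (1 - expR (- (delta ^+ 2 / 4))).

Definition bad_prefix (B : set R) (c : R) (m : nat) : set (Omega E) :=
  [set w | exists k, [/\ (m <= k)%N, (k <= n)%N &
    #|[set i : 'I_n | (i < k)%N && (Z i w \in B)]%SET|%:R <= c * k%:R]%R].

Let measurable_bad_prefix B c m : measurable B -> measurable (bad_prefix B c m).
Proof.
move=> mB; have := measurable_pattern (fun S : {set 'I_n} =>
  exists k, [/\ (m <= k)%N, (k <= n)%N &
    #|[set i : 'I_n | (i < k)%N && (i \in S)]%SET|%:R <= c * k%:R]%R)
  (fun i => measurable_mem (Z i) mB).
congr measurable; apply/seteqP; split => w [k [mk kn H]]; exists k; split => //;
  apply: le_trans H; rewrite ler_nat subset_leq_card//;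
  by apply/fintype.subsetP => i; rewrite !inE.
Qed.

Let bad_prefix_le B p c (x : R) : measurable B -> mu B = p%:E -> c < p -> 8 <= x ->
  (P (bad_prefix B c (Num.truncn (x / 4))) <= (T0_rate (p - c) / x)%:E)%E.
Proof.
move=> mB muB cp x8; apply: le_trans (prefix_count_lower_tail E _ mB muB cp) _.
have d0 : 0 < (p - c) ^+ 2 by rewrite exprn_gt0// subr_gt0.
have r1 : expR (- ((p - c) ^+ 2 / 4)) < 1 by rewrite expR_lt1 oppr_lt0 divr_gt0.
have x0 : 0 < x by rewrite (lt_le_trans _ x8).
rewrite lee_fin /T0_rate [leRHS]mulrAC ler_wpM2r ?invr_ge0 ?subr_ge0 ?(ltW r1)//.
(* Rounding down x / 4 loses at most 1, and 1 <= x / 8. *)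
have mx : x / 8 <= (Num.truncn (x / 4))%:R.
  have : x / 4 < (Num.truncn (x / 4)).+1%:R by exact: truncnS_gt.
  move: (Num.truncn _) => k; rewrite -[k.+1%:R]natr1; lra.
apply: (@le_trans _ _ (expR (- ((p - c) ^+ 2 * x / 32)))).
  rewrite ler_expR lerN2.
  have := ler_wpM2l (ltW d0) mx; lra.
apply: le_trans (expRN_le_inv _) _; first by rewrite divr_gt0// mulr_gt0.
by rewrite invf_div invfM mulrA.
Qed.

Variables (c p pm : R) (h : nat -> R).
Hypotheses (mup : mu `]-oo, (1 / 2)%R]%classic = p%:E)
  (mupm : mu `]-oo, (- (1 / 2))%R]%classic = pm%:E)
  (pmc : pm < c) (cp : c < p) (h0 : 0 < h n).

(** The minimum with 1 covers h > 1, where the alternative is empty but the type I error still has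
    to vanish. The 16 is twice the 8 / x of [B1], which enters both errors. *)
Lemma gamma_T0_le (x : R) : x = n%:R * Num.min 1 (h n) -> 8 <= x ->
  (gamma E (@segments0 R) (h n) (@T0 R c h n) <=
   ((16 + T0_rate (p - c) + T0_rate (c - pm)) / x)%:E)%E.
Proof.
move=> xE x8; set h' := Num.min 1 (h n) in xE.
have h'0 : 0 < h' by rewrite lt_min ltr01.
have h'1 : h' <= 1 by rewrite ge_min lexx.
have h'h : h' <= h n by rewrite ge_min lexx orbT.
have x0 : 0 < x by rewrite (lt_le_trans _ x8).
pose B1 := [set w | (hits `[0, h']%classic (vector X w))%:R <= x / 4].
have mh' : measurable (`[0, h']%classic : set R) by [].
have mB1 : measurable B1.
  exact: (measurable_hits X (fun k => k%:R <= x / 4) mh').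
have PB1 : (P B1 <= (8 / x)%:E)%E.
  have := hits_lower_tail (@dpointP _ _ _ _ E) (lexx 0) (ltW h'0) h'1.
  rewrite subr0 -xE => /(_ _)/le_trans; apply; first lra.
  rewrite lee_fin; apply: le_trans (expRN_le_inv _) _; first by rewrite divr_gt0.
  by rewrite invf_div.
(* [N_stat] counts the points X_i <= h, while [0, t] also asks for X_i >= 0; this null event
   separates the two. *)
pose B0 := [set w | exists i, X i w <= 0].
have mB0 : measurable B0 by exact: measurable_dpoint_le.
have PB0 : (P B0 <= 0)%E.
  have := design_hit_le (@dpointP _ _ _ _ E) (lexx 0) ler01.
  by rewrite mulr0; apply.
pose m := Num.truncn (x / 4).
pose B2 := bad_prefix `]-oo, (1 / 2)%R]%classic c m.
(* With the signal, Y_i <= 1/2 means that the noise is at most -1/2. Too many such indices means too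
   few with noise above -1/2, so the same lower-tail bound serves for both errors. *)
pose B3 := bad_prefix `](- (1 / 2))%R, +oo[%classic (1 - c) m.
have PB2 : (P B2 <= (T0_rate (p - c) / x)%:E)%E by exact: bad_prefix_le.
have PB3 : (P B3 <= (T0_rate (c - pm) / x)%:E)%E.
  have muB3 : mu `](- (1 / 2))%R, +oo[%classic = (1 - pm)%:E.
    rewrite -setCitvl probability_setC// mupm//.
  have -> : c - pm = (1 - pm) - (1 - c) by ring.
  by apply: bad_prefix_le => //; rewrite ltrD2l ltrN2.
have mB2 : measurable B2 by exact: measurable_bad_prefix.
have mB3 : measurable B3 by exact: measurable_bad_prefix.
have NE G w : N_stat (h n) (observe (E := E) G w) = #|[set i | X i w <= h n]%SET|.
  by apply: eq_card => i; rewrite !inE Xs_observe.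
(* By sortedness the first N indices are those with X_i <= h; outside [B0] they all lie in [0, t]
   when t >= h. *)
have ltN (w : Omega E) (i : 'I_n) :
    (i < #|[set i | (X i w <= h n)%R]%SET|)%N = (X i w <= h n).
  rewrite -(@ord_down_closed _ (fun i => X i w <= h n))// => j k jk.
  by apply: le_trans; exact: design_sorted (@dpointP _ _ _ _ E) w _ _ jk.
have Nm (w : Omega E) : ~ B1 w -> (m <= #|[set i | (X i w <= h n)%R]%SET|)%N.
  move=> /negP; rewrite -ltNge => hx.
  rewrite (@leq_trans (hits `[0, h']%classic (vector X w)))//.
    rewrite -(ler_nat R); apply: le_trans (ltW hx).
    by rewrite truncn_le divr_ge0// ltW.
  apply/subset_leq_card/fintype.subsetP => i.
  rewrite !inE /= in_itv/= tnth_vector => /andP[_ Xh].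
  exact: le_trans h'h.
have Nn (w : Omega E) : (#|[set i | (X i w <= h n)%R]%SET| <= n)%N.
  by rewrite -[leqRHS]card_ord max_card.
have mT0 := @measurable_T0 R n c h.
have mev G b : measurable G ->
    measurable [set w | T0 c h (observe (E := E) G w) = b].
  by move=> mG; exact: measurable_observe_test.
rewrite (_ : (_ / x)%:E = (8 / x)%:E + (T0_rate (p - c) / x)%:E +
    ((8 / x)%:E + (0 + (T0_rate (c - pm) / x)%:E)))%E; last first.
  by rewrite add0e -!EFinD; congr EFin; field; rewrite gt_eqF.
apply: gamma_le.
- rewrite add0e -EFinD lee_fin addr_ge0//; first by rewrite divr_ge0// ltW.
  by rewrite -lee_fin; apply: le_trans PB3; exact: measure_ge0.
- apply: (measure_subU2 (mev _ true measurable0) mB1 mB2) => // w.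
  rewrite /= /T0 /S_stat NE => Tw; have [B1w|nB1w] := pselect (B1 w); first by left.
  right; exists #|[set i | X i w <= h n]%SET|; split => //; first exact: Nm.
  move: Tw; congr (_%:R <= _); apply: eq_card => i.
  by rewrite !inE Ys_observe indic0 add0r mem_setE in_itv.
move=> G [t [t0 t1 ->]] lG.
have ht : h n <= t by have := long_itv h0 lG; rewrite subr0.
have m0t : measurable (`[0, t]%classic : set R) by [].
have mB03 : measurable (B0 `|` B3) by exact: measurableU.
have PB03 : (P (B0 `|` B3) <= 0 + (T0_rate (c - pm) / x)%:E)%E.
  exact: (measure_subU2 mB03 mB0 mB3).
have mevt : measurable [set w | ~~ T0 c h (observe (E := E) `[0, t]%classic w)].
  have := mev _ false m0t; congr measurable.
  by apply/seteqP; split => w /=; [move=> ->|move/negbTE].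
apply: (measure_subU2 mevt mB1 mB03) => // w.
rewrite /= /T0 /S_stat NE -ltNge => Tw.
have [B1w|nB1w] := pselect (B1 w); first by left.
have [B0w|nB0w] := pselect (B0 w); first by right; left.
right; right; set N := #|[set i | X i w <= h n]%SET| in Tw *.
exists N; split; [exact: Nm|exact: Nn|].
have XG (i : 'I_n) : (i < N)%N -> X i w \in `[0, t]%classic.
  rewrite ltN mem_setE in_itv/= => Xh; rewrite (le_trans Xh)// andbT.
  by rewrite leNgt; apply/negP => /ltW X0; apply: nB0w; exists i.
set S1 := [set i : 'I_n | _ & _]%SET in Tw.
pose S2 := [set i : 'I_n |
  (i < N)%N && (Z i w \in `](- (1 / 2))%R, +oo[%classic)]%SET.
have S12 : (#|S1| + #|S2| <= N)%N.
  rewrite -cardsUI (_ : S1 :&: S2 = finset.set0) ?cards0 ?addn0.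
    rewrite -[leqRHS](card_ltn_ord (Nn w)).
    apply/subset_leq_card/fintype.subsetP => i.
    by rewrite !inE => /orP[] /andP[].
  apply/setP => i; rewrite !inE; apply/negbTE/negP.
  move=> /andP[/andP[iN +] /andP[_]]; rewrite Ys_observe indicE XG//.
  rewrite mem_setE in_itv/= andbT; lra.
have : #|S1|%:R + #|S2|%:R <= N%:R :> R by rewrite -natrD ler_nat.
move=> S12R; have S2c : #|S2|%:R <= (1 - c) * N%:R.
  by move: Tw S12R; move: (#|S1|%:R) (#|S2|%:R) (N%:R) => s1 s2 m' ? ?; lra.
exact: S2c.
Qed.

End T0_consistency_bound.

(** * Risk of the scan test [T1] *)

Section T1_consistency_bound.
Context (R : realType) (D : design) (mu : probability R R) (n : nat).
Variable E : experiment D mu n.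
Local Notation P := (Prob E).
Local Notation X := (dpoint E).
Local Notation Z := (noise E).

Variables (s : R) (h : nat -> R).
Hypotheses (s0 : 0 < s) (subg : forall u : R,
  (\int[mu]_x (expR (u * x))%:E <= (expR (s ^+ 2 * u ^+ 2 / 2))%:E)%E).
Hypotheses (h0 : forall n, 0 < h n) (nh4 : 4 <= n%:R * h n).
Let x := n%:R * h n.

(** Every segment of length at least h contains a cell of this grid of mesh h / 2, so finitely many
    counts control all long segments. *)
Let cell (k : nat) : set R := `[k%:R * (h n / 2), k.+1%:R * (h n / 2)]%classic.

(** A cell that leaves [0, 1] may well miss the design and is never called bad. *)
Let bad_cell (k : nat) : set (Omega E) :=
  if k.+1%:R * (h n / 2) <= 1 then
    [set w | (hits (cell k) (vector X w))%:R <= x / 8] else set0.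

Let measurable_bad_cell k : measurable (bad_cell k).
Proof.
rewrite /bad_cell; case: ifP => // _.
have mc : measurable (cell k) by exact: measurable_itv.
exact: (measurable_hits X (fun m => m%:R <= x / 8) mc).
Qed.

Let bad_cell_le k : (P (bad_cell k) <= (expR (- (x / 16)))%:E)%E.
Proof.
rewrite /bad_cell; case: ifP => [k1|_]; last by rewrite measure0 lee_fin expR_ge0.
have hn := h0 n.
have k0 : 0 <= k%:R * (h n / 2) by rewrite mulr_ge0// divr_ge0// ltW.
have kk : k%:R * (h n / 2) <= k.+1%:R * (h n / 2).
  by rewrite ler_wpM2r ?ler_nat// divr_ge0// ltW.
have kq : k.+1%:R * (h n / 2) - k%:R * (h n / 2) = h n / 2.
  by rewrite -natr1; ring.
have := hits_lower_tail (@dpointP _ _ _ _ E) k0 kk k1.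
(* A cell has length h / 2, so n (b - a) is x / 2, and nh >= 4 makes it at least 2. *)
have e4 : x / 2 / 4 = x / 8 by field.
have e8 : x / 2 / 8 = x / 16 by field.
rewrite kq mulrA -/x e4 e8; apply.
by move: nh4; rewrite -/x; lra.
Qed.

Let all_hits w a b : (forall k, (k < n)%N -> ~ bad_cell k w) ->
  0 <= a -> b <= 1 -> h n <= b - a ->
  x / 8 < (hits `[a, b]%classic (vector X w))%:R.
Proof.
move=> good a0 b1 hab; have hn := h0 n.
pose k := (Num.truncn (a / (h n / 2))).+1.
have h20 : 0 < h n / 2 by rewrite divr_gt0.
have /andP[k1 k2] := truncn_itv (divr_ge0 a0 (ltW h20)).
rewrite -/k ler_pdivlMr// ltr_pdivrMr// in k1 k2.
have kE : k%:R = (Num.truncn (a / (h n / 2)))%:R + 1 :> R by rewrite natr1.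
have kb : k.+1%:R * (h n / 2) <= b by rewrite -natr1 kE; lra.
(* From (k + 1) h / 2 <= 1 and nh >= 4: checking n cells is enough. *)
have kn : (k < n)%N.
  rewrite -(ltr_nat R) -(ltr_pM2r h20).
  have : k.+1%:R * (h n / 2) = k%:R * (h n / 2) + h n / 2 by rewrite -natr1; ring.
  move: nh4; lra.
have := good _ kn; rewrite /bad_cell (le_trans kb b1) => /negP; rewrite -ltNge.
move=> /lt_le_trans; apply; rewrite ler_nat.
apply/subset_leq_card/fintype.subsetP => i; rewrite !inE /cell/= !in_itv/=.
move=> /andP[ki ik]; apply/andP; split; first exact: le_trans (ltW k2) ki.
exact: le_trans kb.
Qed.

Let block (lr : 'I_n.+1 * 'I_n.+1) : {set 'I_n} :=
  [set i : 'I_n | (lr.1 <= i < lr.2)%N]%SET.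

(** The optimal Chernoff parameter for a deviation of the block sum by a quarter of the block size;
    the sign selects the tail. *)
Let slope (b : bool) : R := (-1) ^+ b / (4 * s ^+ 2).

(** Only blocks longer than x / 8 count: on good cells every long segment yields such a block, and
    the deviation bound is then uniform. *)
Let bad_block (lrb : 'I_n.+1 * 'I_n.+1 * bool) : set (Omega E) :=
  if x / 8 < #|block lrb.1|%:R then
    [set w | #|block lrb.1|%:R / (16 * s ^+ 2) <=
             slope lrb.2 * \sum_(i in block lrb.1) Z i w] else set0.

Let measurable_bad_block lrb : measurable (bad_block lrb).
Proof.
rewrite /bad_block; case: ifP => // _.
set f := fun w => slope lrb.2 * \sum_(i in block lrb.1) Z i w.
have mf : measurable_fun [set: Omega E] f.
  apply: measurable_funM => //; rewrite /f.
  under eq_fun do rewrite big_mkcond/=.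
  apply: measurable_sum => i; case: (i \in _) => //.
rewrite (_ : [set w | _] =
    f @^-1` `[#|block lrb.1|%:R / (16 * s ^+ 2), +oo[%classic).
  by rewrite -[X in measurable X]setTI; exact: mf.
by apply/seteqP; split => w /=; rewrite in_itv/= andbT.
Qed.

Let bad_block_le lrb : (P (bad_block lrb) <= (expR (- (x / (256 * s ^+ 2))))%:E)%E.
Proof.
rewrite /bad_block; case: ifP => [xJ|_]; last by rewrite measure0 lee_fin expR_ge0.
apply: le_trans (chernoff_sum (@noise_indep _ _ _ _ E) (@noise_law _ _ _ _ E)
  _ _ _ subg) _.
have s2 : 0 < s ^+ 2 by rewrite exprn_gt0.
have b2 : slope lrb.2 ^+ 2 = (16 * s ^+ 2 * s ^+ 2)^-1.
  rewrite /slope exprMn sqrr_sign mul1r exprVn; congr (_^-1); ring.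
rewrite b2 lee_fin ler_expR.
(* The exponent is minus the block size over 32 s^2, and the size exceeds x / 8; hence 256 = 8 *
   32. *)
have -> : s ^+ 2 / (16 * s ^+ 2 * s ^+ 2) / 2 * #|block lrb.1|%:R -
    #|block lrb.1|%:R / (16 * s ^+ 2) = - (#|block lrb.1|%:R / 32 / s ^+ 2).
  by field; rewrite gt_eqF.
rewrite lerN2 invfM mulrA ler_pM2r ?invr_gt0//; lra.
Qed.

Let good_block w lr : (forall lrb, ~ bad_block lrb w) -> x / 8 < #|block lr|%:R ->
  `|\sum_(i in block lr) Z i w| < #|block lr|%:R / 4.
Proof.
move=> good xJ; set S := \sum_(i in _) _.
have s2 : 0 < s ^+ 2 by rewrite exprn_gt0.
have H (b : bool) : (-1) ^+ b * S < #|block lr|%:R / 4.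
  have := good (lr, b); rewrite /bad_block/= xJ => /negP; rewrite -ltNge /slope.
  have -> : (-1) ^+ b / (4 * s ^+ 2) * S = ((-1) ^+ b * S) / (4 * s ^+ 2).
    by rewrite mulrAC.
  have -> : #|block lr|%:R / (16 * s ^+ 2) = (#|block lr|%:R / 4) / (4 * s ^+ 2).
    by field; rewrite gt_eqF.
  by rewrite ltr_pM2r// invr_gt0 mulr_gt0.
have := H true; have := H false; rewrite expr0 expr1 mul1r mulN1r => ? ?.
by rewrite ltr_norml; apply/andP; split; lra.
Qed.

Let blockE w (a b : R) : exists lr, 
  [set i | X i w \in `[a, b]%classic]%SET = block lr.
Proof.
pose l := #|[set i : 'I_n | (X i w < a)%R]%SET|.
pose r := #|[set i : 'I_n | (X i w <= b)%R]%SET|.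
have ln : (l < n.+1)%N by rewrite ltnS -[leqRHS]card_ord max_card.
have rn : (r < n.+1)%N by rewrite ltnS -[leqRHS]card_ord max_card.
exists (Ordinal ln, Ordinal rn); apply/setP => i; rewrite !inE/=.
have mono := design_sorted (@dpointP _ _ _ _ E) w.
rewrite mem_setE in_itv/= leNgt.
rewrite (@ord_down_closed _ (fun i => X i w < a)); last first.
  by move=> j k jk; apply: le_lt_trans; exact: mono.
rewrite (@ord_down_closed _ (fun i => X i w <= b)); last first.
  by move=> j k jk; apply: le_trans; exact: mono.
by rewrite -leqNgt.
Qed.

(** The drift delta is -1/2 without signal and 1/2 on the true segment. As the noise sum stays below
    a quarter of the count, delta decides the sign of the score. *)
Let score_observe w (G : set R) (a b : R) (delta : R) :
  (forall i, X i w \in `[a, b]%classic -> \1_G (X i w) - 1 / 2 = delta) ->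
  R_score (observe (E := E) G w) `[a, b]%classic =
  delta * #|[set i | X i w \in `[a, b]%classic]%SET|%:R +
  \sum_(i in [set i | X i w \in `[a, b]%classic]%SET) Z i w.
Proof.
move=> Gd; rewrite R_scoreE -sum1_card natr_sum mulr_sumr -big_split/=.
rewrite [RHS]big_mkcond/=; apply: eq_bigr => i _.
rewrite Ys_observe Xs_observe inE.
have -> : \1_(`[a, b]%classic) (X i w) = (X i w \in `[a, b]%classic)%:R :> R.
  by rewrite indicE.
case: (boolP (X i w \in `[a, b]%classic)) => [Xab|_]; last by rewrite mulr0.
by rewrite !mulr1 -(Gd _ Xab) addrAC.
Qed.

Let bad_cells := [set w | exists2 k, k \in iota 0 n & bad_cell k w].

Let bad_blocks := [set w |
  exists2 lrb, lrb \in enum {: 'I_n.+1 * 'I_n.+1 * bool} & bad_block lrb w].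

Let bound := n%:R * expR (- (x / 16)) +
  2 * (n.+1%:R ^+ 2) * expR (- (x / (256 * s ^+ 2))).

Let measurable_bad_cells : measurable bad_cells.
Proof.
rewrite (_ : bad_cells = \bigcup_(k in [set` iota 0 n]) bad_cell k).
  by apply: bigcup_measurable => k _; exact: measurable_bad_cell.
by apply/seteqP; split => w [k kn kw]; exists k.
Qed.

Let measurable_bad_blocks : measurable bad_blocks.
Proof.
rewrite (_ : bad_blocks =
    \bigcup_(lrb in [set: 'I_n.+1 * 'I_n.+1 * bool]) bad_block lrb).
  apply: fin_bigcup_measurable => [|lrb _]; first exact: finite_finset.
  exact: measurable_bad_block.
apply/seteqP; split => w [k kn kw]; exists k => //.
by rewrite mem_enum inE.
Qed.

Let sum_cst (I : eqType) (r : seq I) (F : I -> \bar R) (c : R) :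
  (forall i, (F i <= c%:E)%E) -> (\sum_(i <- r) F i <= ((size r)%:R * c)%:E)%E.
Proof.
move=> Fc; apply: (@le_trans _ _ (\sum_(i <- r) c%:E)%E); first exact: lee_sum.
by rewrite sumEFin big_const_seq iter_addr_0 count_predT mulr_natl.
Qed.

Let bad_cells_le : (P bad_cells <= (n%:R * expR (- (x / 16)))%:E)%E.
Proof.
apply: le_trans (union_bound _ _ measurable_bad_cell) _.
by apply: le_trans (sum_cst _ bad_cell_le) _; rewrite size_iota.
Qed.

Let bad_blocks_le :
  (P bad_blocks <= (2 * (n.+1%:R ^+ 2) * expR (- (x / (256 * s ^+ 2))))%:E)%E.
Proof.
apply: le_trans (union_bound _ _ measurable_bad_block) _.
apply: le_trans (sum_cst _ bad_block_le) _.
rewrite -cardE !card_prod card_bool !card_ord lee_fin !natrM.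
by rewrite mulrC [in leRHS]mulrC (mulrC 2).
Qed.

Let good_score w (a b : R) : ~ bad_cells w -> ~ bad_blocks w ->
  0 <= a -> b <= 1 -> h n <= b - a ->
  let J := [set i | X i w \in `[a, b]%classic]%SET in
  x / 8 < #|J|%:R /\ `|\sum_(i in J) Z i w| < #|J|%:R / 4.
Proof.
move=> nbc nbb a0 b1 hab J.
have xJ : x / 8 < #|J|%:R.
  rewrite /J -hits_vector; apply: all_hits => // k kn bk.
  apply: nbc; exists k => //.
  by rewrite mem_iota.
split => //; have [lr JE] := blockE w a b.
rewrite /J JE; apply: good_block; last by rewrite -JE.
by move=> lrb blrb; apply: nbb; exists lrb => //; rewrite mem_enum.
Qed.

Let x0 : 0 < x.
Proof. by rewrite (lt_le_trans _ nh4). Qed.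

Lemma gamma_T1_le :
  (gamma E (@segments R) (h n) (@T1 R h n) <= (bound + bound)%:E)%E.
Proof.
have mT1 := @measurable_T1 R n h h0.
rewrite EFinD; apply: gamma_le.
- by rewrite lee_fin addr_ge0// !mulr_ge0// ?exprn_ge0// expR_ge0.
- have m0 := measurable_observe_test E true (@measurable0 _ R) mT1.
  rewrite EFinD.
  apply: (measure_subU2 m0 measurable_bad_cells measurable_bad_blocks) => //.
  move=> w /=; apply: contraPP => /not_orP[nbc nbb].
  rewrite /T1; apply/negP; rewrite -ltNge.
  (* With m points the score is at most - m / 2 + m / 4 < - x / 32, a negative bound common to all
     segments, as a strict inequality for the supremum requires. *)
  apply: (@le_lt_trans _ _ (- (x / 32))%:E); last first.
    by rewrite lte_fin oppr_lt0 divr_gt0.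
  apply: ge_ereal_sup => _ [_ [[a [b [a0 ab b1 ->]]] lG] <-].
  have hab := long_itv (h0 n) lG.
  have [xJ] := good_score nbc nbb a0 b1 hab.
  rewrite lee_fin (@score_observe _ _ _ _ (- (1 / 2))); last first.
    by move=> i _; rewrite indic0 sub0r.
  set S := \sum_(i in _) _; set m := (#|_|)%:R in xJ *.
  rewrite ltr_norml => /andP[S1 S2]; lra.
move=> _ [a [b [a0 ab b1 ->]]] lG.
have mG : measurable (`[a, b]%classic : set R) by [].
have m1 : measurable [set w | ~~ T1 h (observe (E := E) `[a, b]%classic w)].
  have := measurable_observe_test E false mG mT1; congr measurable.
  by apply/seteqP; split => w /=; [move=> ->|move/negbTE].
rewrite EFinD.
apply: (measure_subU2 m1 measurable_bad_cells measurable_bad_blocks) => //.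
move=> w /=; apply: contraPP => /not_orP[nbc nbb].
apply/negP; rewrite negbK /T1.
have hab := long_itv (h0 n) lG.
have [xJ SJ] := good_score nbc nbb a0 b1 hab.
(* The true segment itself is long and already has a nonnegative score. *)
apply: (@le_trans _ _
    (R_score (observe (E := E) `[a, b]%classic w) `[a, b]%classic)%:E).
  rewrite lee_fin (@score_observe _ _ _ _ (1 / 2)); last first.
    by move=> i Xi; rewrite indicE Xi /= mulr1n; lra.
  move: xJ SJ; set S := \sum_(i in _) _; set m := (#|_|)%:R => xJ.
  rewrite ltr_norml => /andP[S1 S2]; have := x0; lra.
apply: ereal_sup_ubound; exists `[a, b]%classic => //; split => //.
by exists a, b.
Qed.

End T1_consistency_bound.

(** * Lower bounds on the risk *)

Lemma in_set_bool (T : Type) (b : T -> bool) (z : T) :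
  (z \in [set z | b z]) = b z.
Proof. by apply/idP/idP; rewrite inE. Qed.

Section lower_bounds.
Context (R : realType) (D : design) (mu : probability R R) (n : nat).
Variable E : experiment D mu n.
Local Notation P := (Prob E).
Local Notation X := (dpoint E).
Local Notation Z := (noise E).
Variable tau : obs R n -> bool.
Hypothesis mtau : measurable_fun [set: obs R n] tau.

Let measurable_test (G : set R) : measurable G ->
  measurable [set w | ~~ tau (observe (E := E) G w)].
Proof.
move=> mG; have := measurable_observe_test E false mG mtau; congr measurable.
by apply/seteqP; split => w /=; [move=> ->|move/negbTE].
Qed.

(* As long as no design point falls into [0, h], the observations under
   [0, h] and under the empty set coincide. *)
Lemma gamma_segments0_ge (h : R) : 0 < h -> h <= 1 -> n%:R * h < 1 ->
  (1 <= gamma E (@segments0 R) h tau + (n%:R * h)%:E)%E.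
Proof.
move=> h0 h1 nh1; pose G := `[0, h]%classic : set R.
have mG : measurable G by exact: measurable_itv.
have SG : segments0 G by exists h; rewrite (ltW h0).
have lG : long h G by apply: itv_long => //; rewrite subr0.
pose A := [set w | tau (observe (E := E) set0 w)].
have mA : measurable A := measurable_observe_test E true (@measurable0 _ R) mtau.
pose B := [set w | exists i, X i w <= h].
have PB : (P B <= (n%:R * h)%:E)%E.
  by have := design_hit_le (@dpointP _ _ _ _ E) (ltW h0) h1; apply.
have PAC : (P (~` A) <=
    P [set w | ~~ tau (observe (E := E) G w)] + (n%:R * h)%:E)%E.
  apply: (measure_subU2 (measurableC mA) (measurable_test mG)
    (measurable_dpoint_le E h)) => // w /= /negP nA.
  have [Bw|nB] := pselect (B w); [by right|left].
  rewrite /= (_ : observe (E := E) G w = observe (E := E) set0 w)//.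
  rewrite observe0E observeE; congr obs_of; apply: eq_from_tnth => i.
  rewrite [LHS]tnth_mktuple indicE (_ : _ \in _ = false) ?add0r//.
  apply/negbTE; rewrite tnth_vector mem_setE in_itv/=; apply/negP => /andP[_ Xh].
  by apply: nB; exists i.
have <- : (P A + P (~` A) = 1)%E.
  by rewrite probability_setC// addeC subeK// fin_num_measure.
apply: le_trans (leeD2l _ PAC) _.
by rewrite addeA leeD2r// gamma_ge.
Qed.

Variable s : R.
Hypotheses (s0 : 0 < s)
  (muE : forall A, measurable A -> mu A = normal_prob 0 s A).

Let L (G : set R) w := expR (log_ratio s G (vector X w) (vector Z w)).

Let s_neq0 : s != 0. Proof. by rewrite gt_eqF. Qed.

Let integral_L (G : set R) (F : n.-tuple R * n.-tuple R -> \bar R) :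
  measurable G ->
  measurable_fun [set: n.-tuple R * n.-tuple R] F -> (forall v, (0 <= F v)%E) ->
  (\int[P]_w (F (vector X w, vector Z w) * (L G w)%:E) =
   \int[P]_w F (vector X w, signal G (vector X w) (vector Z w)))%E.
Proof.
move=> mG mF F0; apply/esym.
exact: (ge0_integral_signal (@noise_indep _ _ _ _ E) (@noise_law _ _ _ _ E)
  s_neq0 muE (@dpoint_noise_indep _ _ _ _ E) mG mF F0).
Qed.

Let measurable_L (G : set R) : measurable G -> measurable_fun [set: Omega E] (L G).
Proof.
move=> mG.
have mXZ := measurable_fun_pair (measurable_vector X) (measurable_vector Z).
exact: (measurableT_comp (measurable_log_ratio s mG) mXZ).
Qed.

Let integral_L1 (G : set R) : measurable G -> (\int[P]_w (L G w)%:E = 1)%E.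
Proof.
move=> mG.
transitivity (\int[P]_w (cst 1%E (vector X w, vector Z w) * (L G w)%:E))%E.
  by apply: eq_integral => w _; rewrite mul1e.
rewrite (integral_L mG (measurable_cst _))//.
by rewrite integral_cst// mul1e; exact: probability_setT.
Qed.

(** One ratio is absorbed into a signal on G'. The ratio of G only reads responses at points of G,
    where that signal vanishes, so its mean is still 1. *)
Let integral_LL (G G' : set R) : measurable G -> measurable G' ->
  G `&` G' = set0 -> (\int[P]_w (L G w * L G' w)%:E = 1)%E.
Proof.
move=> mG mG' GG'.
pose F (vz : n.-tuple R * n.-tuple R) : \bar R :=
  (expR (log_ratio s G vz.1 vz.2))%:E.
have mF : measurable_fun [set: n.-tuple R * n.-tuple R] F.
  by apply/measurable_EFinP; exact: measurable_log_ratio.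
have F0 v : (0 <= F v)%E by rewrite lee_fin expR_ge0.
rewrite -(integral_L1 mG); under eq_integral do rewrite EFinM.
rewrite (integral_L mG' mF F0); apply: eq_integral => w _.
rewrite /F/= /L; congr (expR _)%:E; apply: eq_bigr => i _.
rewrite [tnth (signal _ _ _) _]tnth_mktuple.
have [XG|XG] := boolP (tnth (vector X w) i \in G); last first.
  by rewrite indicE (negbTE XG) !mul0r.
rewrite (_ : \1_G' _ = 0) ?add0r// indicE.
rewrite (_ : _ \in _ = false)//; apply/negbTE/negP => XG'.
have : (G `&` G') (tnth (vector X w) i) by split; rewrite -inE.
by rewrite GG'.
Qed.

(** One ratio is absorbed as a signal, which multiplies the other by exp(N / s^2), N being the
    number of design points in the segment. This factor depends on the design alone, so a second
    change of measure removes the remaining ratio. *)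
Let integral_LLxx (a b : R) : 0 <= a -> a <= b -> b <= 1 ->
  (\int[P]_w (L `[a, b]%classic w * L `[a, b]%classic w)%:E <=
   (expR ((n%:R * (b - a) + 2) * (expR (s ^- 2) - 1)))%:E)%E.
Proof.
move=> a0 ab b1; set G := `[a, b]%classic.
have mG : measurable G by exact: measurable_itv.
pose F (vz : n.-tuple R * n.-tuple R) : \bar R :=
  (expR (log_ratio s G vz.1 vz.2))%:E.
have mF : measurable_fun [set: n.-tuple R * n.-tuple R] F.
  by apply/measurable_EFinP; exact: measurable_log_ratio.
have F0 v : (0 <= F v)%E by rewrite lee_fin expR_ge0.
under eq_integral do rewrite EFinM.
rewrite (integral_L mG mF F0).
pose F' (vz : n.-tuple R * n.-tuple R) : \bar R :=
  (expR (s ^- 2 * (hits G vz.1)%:R))%:E.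
have mF' : measurable_fun [set: n.-tuple R * n.-tuple R] F'.
  apply/measurable_EFinP; apply: (measurableT_comp (@measurable_expR R)).
  apply: (measurable_funM (measurable_cst _)).
  exact: (measurableT_comp (measurable_fun_hits mG) measurable_fst).
have F'0 v : (0 <= F' v)%E by rewrite lee_fin expR_ge0.
have -> : (\int[P]_w F (vector X w, signal G (vector X w) (vector Z w)) =
    \int[P]_w (F' (vector X w, vector Z w) * (L G w)%:E))%E.
  apply: eq_integral => w _; rewrite /F /F' /L/= -EFinM -expRD; congr (expR _)%:E.
  rewrite hits_sum mulr_sumr /log_ratio -big_split/=; apply: eq_bigr => i _.
  rewrite [tnth (signal _ _ _) _]tnth_mktuple indicE.
  by case: (_ \in _) => /=; [field|rewrite !mul0r mulr0 addr0].
rewrite (integral_L mG mF' F'0) /F'/=.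
apply: (ge0_integral_hits_le (@dpointP _ _ _ _ E)) => //.
by rewrite invr_ge0 sqr_ge0.
Qed.

Variables (M : nat) (h : R).
Hypotheses (M0 : (0 < M)%N) (h0 : 0 < h) (Mh : (2 * M)%:R * h <= 1).

(** Gaps of length h keep the closed segments disjoint. *)
Let G_ (k : 'I_M) : set R := `[(2 * k)%:R * h, (2 * k)%:R * h + h]%classic.

Let GP (k : 'I_M) : [/\ 0 <= (2 * k)%:R * h, (2 * k)%:R * h <= (2 * k)%:R * h + h &
  (2 * k)%:R * h + h <= 1].
Proof.
split; rewrite ?mulr_ge0 ?ler0n ?(ltW h0) ?lerDl ?(ltW h0)//.
apply: le_trans Mh; rewrite -{2}[h]mul1r -mulrDl ler_wpM2r ?(ltW h0)//.
by rewrite natr1 ler_nat; have := ltn_ord k; lia.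
Qed.

Let G_disj j k : j != k -> G_ j `&` G_ k = set0.
Proof.
wlog jk : j k / (j < k)%N.
  move=> H jk; have := jk; rewrite neq_ltn => /orP[jk'|kj]; first exact: H.
  by rewrite setIC; apply: H => //; rewrite eq_sym.
move=> _; apply/seteqP; split => y //=.
rewrite /G_/= !in_itv/= => -[/andP[_ yj] /andP[ky _]].
have : (2 * j)%:R * h + h < (2 * k)%:R * h.
  rewrite -{2}[h]mul1r -mulrDl ltr_pM2r// natr1 ltr_nat.
  by lia.
by rewrite ltNge (le_trans ky yj).
Qed.

(* Second moment method: with [Lbar] the average likelihood ratio over M
   disjoint segments, min(1, Lbar) >= Lbar - Lbar^2 / 4. *)
Lemma gamma_segments_ge :
  expR ((n%:R * h + 2) * (expR (s ^- 2) - 1)) <= M%:R ->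
  (2^-1%:E <= gamma E (@segments R) h tau)%E.
Proof.
set B := expR _ => BM.
have mG k : measurable (G_ k) by exact: measurable_itv.
have SG k : segments (G_ k).
  by have [? ? ?] := GP k; exists ((2 * k)%:R * h), ((2 * k)%:R * h + h).
have lG k : long h (G_ k) by apply: itv_long => //; rewrite addrC addKr.
set g := gamma _ _ _ _.
have Mr0 : 0 < M%:R :> R by rewrite ltr0n.
pose A := [set w | tau (observe (E := E) set0 w)].
have mA : measurable A := measurable_observe_test E true (@measurable0 _ R) mtau.
pose t w : R := \1_A w.
pose t' w : R := \1_(~` A) w.
have mt : measurable_fun [set: Omega E] t by exact: measurable_indic.
have mt' : measurable_fun [set: Omega E] t'.
  by apply: measurable_indic; exact: measurableC.
have t0 w : 0 <= t w by [].
have t'0 w : 0 <= t' w by [].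
pose S w := \sum_k L (G_ k) w.
have mS : measurable_fun [set: Omega E] S.
  by apply: measurable_sum => k; exact: measurable_L.
have S0 w : 0 <= S w by apply: sumr_ge0 => k _; exact: expR_ge0.
(* Here S is M times [Lbar]. If the test rejects, this is (2M - S)^2 >= 0; otherwise the middle term
   alone equals S. *)
have key w : S w <= M%:R * t w + t' w * S w + S w ^+ 2 / (4 * M%:R).
  rewrite -subr_ge0 /t /t' !indicE in_setC; case: (w \in A) => /=.
    rewrite mulr1 mul0r addr0.
    have -> : M%:R + S w ^+ 2 / (4 * M%:R) - S w =
        (2 * M%:R - S w) ^+ 2 / (4 * M%:R).
      by field; rewrite gt_eqF.
    by rewrite divr_ge0 ?sqr_ge0// mulr_ge0.
  by rewrite mulr0 mul1r add0r addrAC subrr add0r divr_ge0 ?sqr_ge0// mulr_ge0.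
have intS : (\int[P]_w (S w)%:E = (M%:R)%:E)%E.
  under eq_integral do rewrite /S -sumEFin.
  rewrite ge0_integral_sum//.
  - rewrite (eq_bigr (fun=> 1%E)); last by move=> k _; exact: integral_L1.
    by rewrite sumEFin sumr_const card_ord.
  - by move=> k; apply/measurable_EFinP; exact: measurable_L.
  - by move=> k w _; rewrite lee_fin expR_ge0.
have intt : (\int[P]_w (t w)%:E = P A)%E by rewrite integral_indic// setIT.
pose p k := fine (P [set w | ~~ tau (observe (E := E) (G_ k) w)]).
(* By the change of measure, weighting acceptance by the ratio gives the type II error at [G_ k]. *)
have intt' k : (\int[P]_w (t' w * L (G_ k) w)%:E = (p k)%:E)%E.
  rewrite fineK ?fin_num_measure//; last exact: measurable_test.
  pose F (vz : n.-tuple R * n.-tuple R) : \bar R :=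
    (\1_[set z | ~~ tau z] (obs_of vz.1 vz.2))%:E.
  have mF : measurable_fun [set: n.-tuple R * n.-tuple R] F.
    apply/measurable_EFinP.
    apply: (measurableT_comp _ (@measurable_obs_of R n)); apply: measurable_indic.
    have := mtau; move=> /(_ measurableT [set false] I); rewrite setTI.
    congr measurable.
    by apply/seteqP; split => z /=; [move=> ->|move/negbTE].
  have F0 v : (0 <= F v)%E by rewrite lee_fin.
  transitivity (\int[P]_w (F (vector X w, vector Z w) * (L (G_ k) w)%:E))%E.
    apply: eq_integral => w _; rewrite EFinM; congr (_%:E * _)%E.
    by rewrite /t' !indicE in_setC !in_set_bool -observe0E.
  rewrite (integral_L (mG k) mF F0).
  transitivity (\int[P]_w (\1_[set w | ~~ tau (observe (E := E) (G_ k) w)] w)%:E)%E.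
    by apply: eq_integral => w _; rewrite /F/= -observeE !indicE !in_set_bool.
  by rewrite integral_indic// ?setIT//; exact: measurable_test.
have mLL j k : measurable_fun [set: Omega E] (fun w => L (G_ j) w * L (G_ k) w).
  by apply: measurable_funM; exact: measurable_L.
have LL0 j k w : 0 <= L (G_ j) w * L (G_ k) w by rewrite mulr_ge0// expR_ge0.
have intS2 : (\int[P]_w (S w ^+ 2)%:E <= (2 * M%:R ^+ 2)%:E)%E.
  have -> : (\int[P]_w (S w ^+ 2)%:E =
      \sum_(j < M) \sum_(k < M) \int[P]_w (L (G_ j) w * L (G_ k) w)%:E)%E.
    transitivity (\int[P]_w
        \sum_(j < M) \sum_(k < M) (L (G_ j) w * L (G_ k) w)%:E)%E.
      apply: eq_integral => w _; rewrite expr2 /S big_distrlr/= -sumEFin.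
      by apply: eq_bigr => j _; rewrite sumEFin.
    rewrite ge0_integral_sum//.
    - apply: eq_bigr => j _; rewrite ge0_integral_sum//.
      + by move=> k; exact/measurable_EFinP.
      + by move=> k w _; rewrite lee_fin.
    - by move=> j; apply: emeasurable_sum => k; exact/measurable_EFinP.
    - by move=> j w _; apply: sume_ge0 => k _; rewrite lee_fin.
  (* In row j the diagonal term is at most B and each other term is 1; the total M (B + M) is at
     most 2 M^2 since B <= M. *)
  apply: (@le_trans _ _ (\sum_(j < M) (B + M%:R)%:E)%E); last first.
    rewrite sumEFin sumr_const card_ord lee_fin -mulr_natl.
    by have := ler_wpM2l (ltW Mr0) BM; lra.
  apply: lee_sum => j _; rewrite (bigD1 j)//= EFinD leeD//.
    have [j0 jj j1] := GP j; have := integral_LLxx j0 jj j1.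
    have -> : (2 * j)%:R * h + h - (2 * j)%:R * h = h by ring.
    by [].
  rewrite (eq_bigr (fun=> 1%E)); last first.
    by move=> k kj; rewrite integral_LL// G_disj// eq_sym.
  rewrite sumEFin lee_fin (sumr_const (predC1 j)) ler_nat.
  by rewrite -[leqRHS]card_ord max_card.
pose a := fine (P A).
have aE : a%:E = P A by rewrite fineK// fin_num_measure.
(* Integral of [key]; its quadratic term contributes at most 2 M^2 / (4M) = M / 2. *)
have sum_le : M%:R <= \sum_(k < M) (a + p k) + M%:R / 2.
  rewrite -lee_fin -intS.
  have mtS : measurable_fun [set: Omega E] (fun w => t' w * S w).
    exact: measurable_funM.
  have mS2 : measurable_fun [set: Omega E] (fun w => S w ^+ 2).
    exact: measurable_funX.
  have c0 : 0 <= (4 * M%:R)^-1 :> R by rewrite invr_ge0 mulr_ge0.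
  apply: (@le_trans _ _ (\int[P]_w ((M%:R%:E * (t w)%:E + (t' w * S w)%:E) +
      ((4 * M%:R)^-1)%:E * (S w ^+ 2)%:E))%E).
    apply: ge0_le_integral => //.
    - by move=> w _; rewrite lee_fin.
    - exact/measurable_EFinP.
    - apply: emeasurable_funD.
        apply: emeasurable_funD; last exact/measurable_EFinP.
        by apply: measurable_funeM; exact/measurable_EFinP.
      by apply: measurable_funeM; exact/measurable_EFinP.
    - by move=> w _; rewrite -!EFinM -!EFinD lee_fin [_^-1 * _]mulrC.
  rewrite ge0_integralD//; first last.
  - by apply: measurable_funeM; exact/measurable_EFinP.
  - by move=> w _; rewrite mule_ge0// lee_fin// sqr_ge0.
  - apply: emeasurable_funD; last exact/measurable_EFinP.
    by apply: measurable_funeM; exact/measurable_EFinP.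
  - by move=> w _; rewrite adde_ge0 ?mule_ge0 ?lee_fin// mulr_ge0.
  rewrite ge0_integralD//; first last.
  - exact/measurable_EFinP.
  - by move=> w _; rewrite lee_fin mulr_ge0.
  - by apply: measurable_funeM; exact/measurable_EFinP.
  - by move=> w _; rewrite mule_ge0// lee_fin.
  have Zl (f : Omega E -> R) (k : R) : measurable_fun [set: Omega E] f ->
      (forall w, 0 <= f w) -> 0 <= k ->
      (\int[P]_w (k%:E * (f w)%:E) = k%:E * \int[P]_w (f w)%:E)%E.
    move=> mf f0 k0; rewrite ge0_integralZl//; first exact/measurable_EFinP.
    by move=> w _; rewrite lee_fin.
  rewrite (Zl t)// (Zl (fun w => S w ^+ 2))//; last by move=> w; exact: sqr_ge0.
  have -> : (\int[P]_w (t' w * S w)%:E = \sum_(k < M) (p k)%:E)%E.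
    transitivity (\int[P]_w \sum_(k < M) (t' w * L (G_ k) w)%:E)%E.
      by apply: eq_integral => w _; rewrite /S mulr_sumr sumEFin.
    rewrite ge0_integral_sum//; first exact: eq_bigr.
    - move=> k; apply/measurable_EFinP; apply: measurable_funM => //.
      exact: measurable_L.
    - by move=> k w _; rewrite lee_fin mulr_ge0// expR_ge0.
  rewrite intt -aE big_split/= sumr_const card_ord -[a *+ M]mulr_natl.
  rewrite sumEFin -EFinM -EFinD [leRHS]EFinD leeD2l//.
  apply: (@le_trans _ _ (((4 * M%:R)^-1)%:E * (2 * M%:R ^+ 2)%:E)%E).
    by rewrite lee_wpmul2l// lee_fin.
  rewrite -EFinM lee_fin le_eqVlt; apply/orP; left; apply/eqP.
  by field; rewrite gt_eqF.
(* The average of the error sums is at least 1/2, so one segment reaches it. *)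
have [k pk] : exists k, 2^-1 <= a + p k.
  apply: contrapT => /forallNP H.
  have : \sum_(k < M) (a + p k) < \sum_(k < M) 2^-1.
    apply: ltr_sum.
      by apply/hasP; exists (Ordinal M0); rewrite ?mem_index_enum.
    by move=> k _; rewrite ltNge; apply/negP; exact: H.
  by rewrite sumr_const card_ord -[2^-1 *+ M]mulr_natl; move: sum_le; lra.
apply: (@le_trans _ _ (a + p k)%:E); first by rewrite lee_fin.
rewrite EFinD aE fineK ?fin_num_measure//; last exact: measurable_test.
exact: gamma_ge.
Qed.

End lower_bounds.

(** * Rates *)

Section limits.
Context (R : realType).

Lemma cvge0_le (g : nat -> \bar R) : (forall n, (0 <= g n)%E) ->
  (forall e : R, 0 < e -> \forall n \near \oo, (g n <= e%:E)%E) ->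
  g n @[n --> \oo] --> 0%E.
Proof.
move=> g0 ge; apply/fine_cvgP; split.
  near=> n; rewrite ge0_fin_numE//.
  apply: (@le_lt_trans _ _ 1%:E); last exact: ltry.
  by near: n; exact: ge.
apply/cvgr0Pnorm_le => e e0; near=> n.
have gn : (g n <= e%:E)%E by near: n; exact: ge.
have gf : g n \is a fin_num by rewrite ge0_fin_numE// (le_lt_trans gn)// ltry.
by rewrite /= ger0_norm ?fine_ge0// -lee_fin fineK.
Unshelve. all: by end_near. Qed.

Lemma cvge0_lt (g : nat -> \bar R) (e : R) : g n @[n --> \oo] --> 0%E -> 0 < e ->
  \forall n \near \oo, (g n < e%:E)%E.
Proof.
move=> /fine_cvgP[gf /cvgr0Pnorm_lt/(_ e)] ge e0; near=> n.
have gn : g n \is a fin_num by near: n.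
have : `|fine (g n)| < e by near: n; exact: ge.
by move=> /(le_lt_trans (ler_norm _)); rewrite -lte_fin fineK.
Unshelve. all: by end_near. Qed.

Lemma near_ge_natr (A : R) : \forall n \near \oo, A <= n%:R.
Proof. by apply: nbhs_infty_ger. Qed.

(* Here [L] stands for ln n: for h = o(ln n / n), the second moment of a
   likelihood ratio is negligible with respect to 1 / h. *)
Lemma second_moment_bound (C L h : R) : 0 <= C -> 0 <= L -> 0 < h ->
  expR L * h <= expR (- (2 * (C + 1))) / (16 * (C + 1)) * L ->
  h <= 1 / 4 /\ expR ((expR L * h + 2) * C) * (4 * h) <= 1.
Proof.
(* The constant e is chosen to give e C <= 1/4, hence exp(e L C) <= exp(L / 4), and e^(2C) e <=
   1/16, which absorbs the final factor 16. *)
move=> C0 L0 h0; set e := expR _ / _ => hL.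
have D1 : 1 <= C + 1 by lra.
have e_gt0 : 0 < e by rewrite divr_gt0 ?expR_gt0// mulr_gt0//; lra.
have ED : expR (- (2 * (C + 1))) <= 1.
  by rewrite -[leRHS]expR0 ler_expR oppr_le0; lra.
have e1 : e * (16 * (C + 1)) <= 1.
  by rewrite /e divfK ?gt_eqF ?mulr_gt0//; lra.
have eC : e * C <= 1 / 4 by nra.
have e2C : expR (2 * C) * e <= 1 / 16.
  have -> : expR (2 * C) * e = expR (- 2) / (16 * (C + 1)).
    by rewrite /e mulrA -expRD; congr (expR _ / _); ring.
  rewrite ler_pdivrMr ?mulr_gt0//; last lra.
  have : expR (- 2) <= 1 :> R by rewrite -[leRHS]expR0 ler_expR oppr_le0.
  lra.
have L1 := expR_ge1Dx L.
have EL : 0 < expR L by exact: expR_gt0.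
have he : h <= e * L * expR (- L).
  by rewrite expRN ler_pdivlMr// mulrC.
split.
  have : expR L * h <= e * expR L.
    by apply: le_trans hL _; rewrite ler_wpM2l ?(ltW e_gt0)//; lra.
  by rewrite mulrC ler_pM2r//; nra.
have E1 : expR ((expR L * h + 2) * C) <= expR (2 * C) * expR (L / 4).
  rewrite -expRD ler_expR.
  have : expR L * h * C <= e * L * C by rewrite ler_wpM2r.
  have : e * C * L <= 1 / 4 * L by rewrite ler_wpM2r.
  lra.
(* Turns the leftover factor L into an exponential: the powers of e then combine to exp(- L / 2) <=
   1. *)
have L4 : L / 4 <= expR (L / 4) by have := expR_ge1Dx (L / 4); lra.
apply: (@le_trans _ _ (expR (2 * C) * expR (L / 4) * (4 * (e * L * expR (- L))))).
  by rewrite ler_pM ?expR_ge0 ?mulr_ge0 ?(ltW h0)// ler_wpM2l.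
have -> : expR (2 * C) * expR (L / 4) * (4 * (e * L * expR (- L))) =
    16 * (expR (2 * C) * e) * (expR (L / 4) * expR (- L) * (L / 4)) by field.
have E2 : expR (L / 4) * expR (- L) * (L / 4) <= 1.
  apply: (@le_trans _ _ (expR (L / 4) * expR (- L) * expR (L / 4))).
    by rewrite ler_wpM2l// mulr_ge0 ?expR_ge0.
  by rewrite -!expRD -[leRHS]expR0 ler_expR; lra.
apply: (@le_trans _ _ (16 * (1 / 16) * 1)); last lra.
apply: ler_pM => //.
- by apply: mulr_ge0 => //; apply: mulr_ge0; [exact: expR_ge0|exact: ltW].
- by apply: mulr_ge0; [apply: mulr_ge0; exact: expR_ge0|exact: divr_ge0].
- by rewrite ler_wpM2l.
Qed.

Lemma ln_ge1 (n : nat) : expR 1 <= n%:R :> R -> 1 <= ln (n%:R : R).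
Proof.
move=> en; have n0 : 0 < n%:R :> R by rewrite (lt_le_trans _ en)// expR_gt0.
by rewrite -[leLHS]expRK ler_ln ?posrE ?expR_gt0.
Qed.

(** The constants 32 = 2 * 16 and 768 = 3 * 256 make the exponentials at most n^(-2) and n^(-3),
    which beat the n cells and the 2 (n + 1)^2 signed blocks; with n + 1 <= 2n this gives 9 = 1 + 2
    * 4. *)
Lemma T1_bound_le (s x : R) (n : nat) : 0 < s -> expR 1 <= n%:R :> R ->
  Num.max 32 (768 * s ^+ 2) * ln n%:R <= x ->
  n%:R * expR (- (x / 16)) + 2 * (n.+1%:R ^+ 2) * expR (- (x / (256 * s ^+ 2)))
    <= 9 / n%:R.
Proof.
move=> s0 en Ax; have L1 := ln_ge1 en; set L := ln _ in Ax L1.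
have n0 : 0 < n%:R :> R by rewrite (lt_le_trans _ en)// expR_gt0.
have nE : expR L = n%:R by rewrite /L lnK.
have s2 : 0 < s ^+ 2 by rewrite exprn_gt0.
have x1 : 32 * L <= x.
  by apply: le_trans Ax; rewrite ler_wpM2r ?le_max ?lexx//; lra.
have x2 : 768 * s ^+ 2 * L <= x.
  by apply: le_trans Ax; rewrite ler_wpM2r ?le_max ?lexx ?orbT//; lra.
have e1 : expR (- (x / 16)) <= (n%:R ^+ 2)^-1.
  rewrite -nE -expRM_natl -expRN ler_expR lerN2; lra.
have e2 : expR (- (x / (256 * s ^+ 2))) <= (n%:R ^+ 3)^-1.
  rewrite -nE -expRM_natl -expRN ler_expR lerN2 ler_pdivlMr ?mulr_gt0//; lra.
have n1 : n.+1%:R <= 2 * n%:R :> R.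
  by rewrite -natr1; have := @ler0n R n; move: n0; rewrite ltr0n -(ler_nat R); lra.
apply: (@le_trans _ _ (n%:R * (n%:R ^+ 2)^-1 +
    2 * ((2 * n%:R) ^+ 2) * (n%:R ^+ 3)^-1)).
  apply: lerD; first by rewrite ler_wpM2l.
  rewrite ler_pM ?mulr_ge0 ?exprn_ge0 ?expR_ge0// ler_wpM2l// ler_pXn2r ?nnegrE//.
by rewrite le_eqVlt; apply/orP; left; apply/eqP; field; rewrite gt_eqF.
Qed.

End limits.

Section rates.
Context (R : realType) (D : design) (mu : probability R R).
Variable E : forall n : nat, experiment D mu n.

Lemma T0_consistent (c : R) (h : nat -> R) :
  (mu `]-oo, (- (1 / 2))%R]%classic < c%:E)%E ->
  (c%:E < mu `]-oo, (1 / 2)%R]%classic)%E ->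
  (forall n, 0 < h n) -> n%:R * h n @[n --> \oo] --> +oo ->
  consistent E (@segments0 R) h (T0 c h).
Proof.
move=> muc cmu h0 nh; split; first by move=> n; exact: measurable_T0.
have fE A : measurable A -> mu A = (fine (mu A))%:E.
  by move=> mA; rewrite fineK// fin_num_measure.
set pm := fine (mu `]-oo, (- (1 / 2))%R]%classic).
set p := fine (mu `]-oo, (1 / 2)%R]%classic).
have mupm : mu `]-oo, (- (1 / 2))%R]%classic = pm%:E by exact: fE.
have mup : mu `]-oo, (1 / 2)%R]%classic = p%:E by exact: fE.
have pmc : pm < c by rewrite -lte_fin -mupm.
have cp : c < p by rewrite -lte_fin -mup.
apply: cvge0_le => [n|e e0]; first exact: gamma_ge0.
set C := 16 + T0_rate (p - c) + T0_rate (c - pm).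
pose A := Num.max 8 (C / e).
move/cvgryPge/(_ A) : nh => nh.
near=> n.
pose x := n%:R * Num.min 1 (h n).
have xA : A <= x.
  rewrite /x; case: (leP 1 (h n)) => _; last by near: n.
  by rewrite mulr1; near: n; exact: near_ge_natr.
have x8 : 8 <= x by apply: le_trans xA; rewrite le_max lexx.
apply: le_trans (gamma_T0_le (E n) mup mupm pmc cp (h0 n) (erefl x) x8) _.
rewrite lee_fin -/C ler_pdivrMr; last by rewrite (lt_le_trans _ x8).
by rewrite mulrC -ler_pdivrMr// (le_trans _ xA)// le_max lexx orbT.
Unshelve. all: by end_near. Qed.

Lemma no_consistent_segments0 (h : nat -> R) : (forall n, 0 < h n) ->
  n%:R * h n @[n --> \oo] --> 0 ->
  ~ exists tau, consistent E (@segments0 R) h tau.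
Proof.
move=> h0 nh [tau [mtau gamma0]].
near \oo => n.
have nh2 : n%:R * h n < 1 / 2.
  near: n; move/cvgr0Pnorm_lt : nh => /(_ (1 / 2)) nh.
  have := nh ltac:(lra); apply: filterS => n.
  exact: le_lt_trans (ler_norm _).
have gn : (gamma (E n) (@segments0 R) (h n) (tau n) < (1 / 2)%:E)%E.
  by near: n; apply: cvge0_lt => //; lra.
have n1 : 1 <= n%:R :> R by near: n; exact: near_ge_natr.
have h1 : h n <= 1.
  by have : 0 <= (n%:R - 1) * h n; [rewrite mulr_ge0 ?subr_ge0 ?(ltW (h0 n))|lra].
have nh1 : n%:R * h n < 1 by lra.
have := gamma_segments0_ge (E n) (mtau n) (h0 n) h1 nh1.
apply/negP; rewrite -ltNge.
have -> : (1 = (1 / 2)%:E + (1 / 2)%:E :> \bar R)%E.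
  by rewrite -EFinD; congr EFin; lra.
by rewrite lteD// lte_fin.
Unshelve. all: by end_near. Qed.

Lemma T1_consistent (h : nat -> R) : subgaussian mu ->
  (forall n, 0 < h n) ->
  n%:R * h n / ln n%:R @[n --> \oo] --> +oo ->
  consistent E (@segments R) h (T1 h).
Proof.
move=> [s s0 subg] h0 nh; split; first by move=> n; exact: measurable_T1.
apply: cvge0_le => [n|e e0]; first exact: gamma_ge0.
move/cvgryPge/(_ (Num.max 32 (768 * s ^+ 2))) : nh => nh.
near=> n.
have en : expR 1 <= n%:R :> R by near: n; exact: near_ge_natr.
have ne : 18 / e <= n%:R by near: n; exact: near_ge_natr.
have n0 : 0 < n%:R :> R by rewrite (lt_le_trans _ en)// expR_gt0.
have L1 := ln_ge1 en.
have L0 : 0 < ln n%:R :> R by lra.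
have Ax : Num.max 32 (768 * s ^+ 2) * ln n%:R <= n%:R * h n.
  by rewrite -ler_pdivlMr//; near: n.
have nh4 : 4 <= n%:R * h n.
  apply: le_trans Ax; apply: (@le_trans _ _ (32 * 1)); first lra.
  by rewrite ler_pM// le_max lexx.
apply: le_trans (gamma_T1_le (E n) s0 subg h0 nh4) _.
rewrite lee_fin; have B := T1_bound_le s0 en Ax.
apply: le_trans (lerD B B) _.
rewrite -mulrDl ler_pdivrMr// mulrC -ler_pdivrMr//.
by apply: le_trans ne; rewrite ler_wpM2r ?invr_ge0 ?(ltW e0)//; lra.
Unshelve. all: by end_near. Qed.

Lemma no_consistent_segments (h : nat -> R) : gaussian mu ->
  (forall n, 0 < h n) ->
  h n / (ln n%:R / n%:R) @[n --> \oo] --> 0 ->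
  ~ exists tau, consistent E (@segments R) h tau.
Proof.
move=> [s s0 muE] h0 nh [tau [mtau gamma0]].
pose C := expR (s ^- 2) - 1.
have C0 : 0 <= C.
  by rewrite subr_ge0 -[leLHS]expR0 ler_expR invr_ge0 sqr_ge0.
pose e := expR (- (2 * (C + 1))) / (16 * (C + 1)).
have e0 : 0 < e by rewrite divr_gt0 ?expR_gt0// mulr_gt0//; lra.
near \oo => n.
have gn : (gamma (E n) (@segments R) (h n) (tau n) < (2^-1)%:E)%E.
  by near: n; apply: cvge0_lt.
have en : expR 1 <= n%:R :> R by near: n; exact: near_ge_natr.
have n0 : 0 < n%:R :> R by rewrite (lt_le_trans _ en)// expR_gt0.
have L1 := ln_ge1 en.
have L0 : 0 < ln n%:R :> R by lra.
have he : h n / (ln n%:R / n%:R) <= e.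
  near: n; move/cvgr0Pnorm_le : nh => /(_ e e0); apply: filterS => n.
  exact: le_trans (ler_norm _).
have nE : expR (ln n%:R) = n%:R :> R by rewrite lnK.
have hL : expR (ln n%:R) * h n <= e * ln n%:R.
  by move: he; rewrite nE invf_div mulrA ler_pdivrMr// mulrC.
have [h4] := second_moment_bound C0 (ltW L0) (h0 n) hL.
rewrite nE => Bh.
pose M := Num.truncn ((2 * h n)^-1).
have h20 : 0 < 2 * h n by rewrite mulr_gt0.
have /andP[M1 M2] : M%:R <= (2 * h n)^-1 < M.+1%:R.
  by apply: truncn_itv; rewrite invr_ge0 ltW.
(* As h <= 1/4, the number y = 1 / (4h) is at least 1, so rounding 2y down to M leaves at least
   y. *)
have hM : (4 * h n)^-1 <= M%:R.
  have M2' : (2 * h n)^-1 < M%:R + 1 by rewrite natr1.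
  have : 1 <= (4 * h n)^-1.
    by rewrite -[leLHS]invr1 lef_pV2 ?posrE ?mulr_gt0//; lra.
  have e2 : (2 * h n)^-1 = 2 * (4 * h n)^-1 by field; rewrite gt_eqF.
  by rewrite e2 in M2'; lra.
have M0 : (0 < M)%N.
  by rewrite -(ltr_nat R) (lt_le_trans _ hM)// invr_gt0 mulr_gt0.
have Mh : (2 * M)%:R * h n <= 1.
  by move: M1; rewrite -[X in _ <= X]mul1r ler_pdivlMr// natrM; lra.
have BM : expR ((n%:R * h n + 2) * (expR (s ^- 2) - 1)) <= M%:R.
  apply: le_trans hM; rewrite -[leRHS]mul1r ler_pdivlMr// mulr_gt0//.
have := gamma_segments_ge (E n) (mtau n) s0 muE M0 (h0 n) Mh BM.
by rewrite leNgt gn.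
Unshelve. all: by end_near. Qed.

End rates.

Theorem theorem1 (R : realType) (D : design) (mu : probability R R)
    (E : forall n : nat, experiment D mu n) (hmu : subgaussian mu) :
  ((mu `]-oo, (- (1 / 2))%R]%classic < mu `]-oo, (1 / 2)%R]%classic)%E ->
    (forall (c : R) (h : nat -> R),
       (mu `]-oo, (- (1 / 2))%R]%classic < c%:E)%E -> (c%:E < mu `]-oo, (1 / 2)%R]%classic)%E ->
       (forall n, 0 < h n) ->
       n%:R * h n @[n --> \oo] --> +oo ->
       consistent E (@segments0 R) h (T0 c h)) /\
    (gaussian mu ->
       separation_rate E (@segments0 R) (fun n => 1 / n%:R))) /\
  ((forall h : nat -> R,
      (forall n, 0 < h n) ->
      n%:R * h n / ln n%:R @[n --> \oo] --> +oo ->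
      consistent E (@segments R) h (T1 h)) /\
   (gaussian mu ->
      separation_rate E (@segments R) (fun n => ln n%:R / n%:R))).
Proof.
split; [move=> mu_lt; split | split].
- by move=> c h muc cmu h0 nh; exact: T0_consistent.
- move=> _; split.
    near=> n; rewrite div1r invr_gt0.
    by apply: (@lt_le_trans _ _ 1) => //; near: n; exact: near_ge_natr.
  move=> h h0; have hE : (fun n => h n / (1 / n%:R)) = (fun n => n%:R * h n).
    by apply/funext => n; rewrite div1r invrK mulrC.
  rewrite hE; split; last exact: no_consistent_segments0.
  move=> nh; pose p A := fine (mu A).
  have pE A : measurable A -> mu A = (p A)%:E.
    by move=> mA; rewrite fineK// fin_num_measure.
  have mu_fin : p `]-oo, (- (1 / 2))%R]%classic < p `]-oo, (1 / 2)%R]%classic.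
    by rewrite -lte_fin -!pE.
  (* The midpoint of the two probabilities is an admissible threshold c. *)
  exists (T0 ((p `]-oo, (- (1 / 2))%R]%classic + p `]-oo, (1 / 2)%R]%classic) / 2) h).
  by apply: T0_consistent => //; rewrite pE// lte_fin; lra.
- by move=> h h0 nh; exact: T1_consistent.
- move=> gmu; split.
    near=> n; have en : expR 1 <= n%:R :> R by near: n; exact: near_ge_natr.
    have n0 : 0 < n%:R :> R by rewrite (lt_le_trans _ en)// expR_gt0.
    by rewrite divr_gt0// (lt_le_trans _ (ln_ge1 en)).
  move=> h h0; split; last exact: no_consistent_segments.
  move=> nh; exists (T1 h); apply: T1_consistent => //.
  rewrite (_ : (fun n => _) = (fun n => h n / (ln n%:R / n%:R)))//.
  by apply/funext => n; rewrite invf_div mulrCA mulrA.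
Unshelve. all: by end_near. Qed.
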